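(* Let $a,b\ge 2$ be integers and $n=ab$. The $(1^b)$-summand $U_{(b),a}$ of the Foulkes module $F_{(b)}^a$ restricted to $S_b\times S_{n-b}$ (as defined in the context) satisfies $$U_{(b),a}\cong\bigoplus_{\lambda\vdash b}S^\lambda\times F_\lambda^{a-1}$$ as $S_b\times S_{n-b}$-modules. In particular, for $a=2$, $$U_{(b),2}\cong\bigoplus_{\lambda\vdash b}S^\lambda\times S^\lambda.$$
   Context: All modules are over $\mathbb{C}$. For a partition $\nu\vdash b$, $S^\nu$ is the Specht module of $S_b$ ($S^{(b)}$ trivial, $S^{(1^b)}$ sign). For integers $a\ge1$, $b\ge 2$, $S_a\wr S_b\le S_{ab}$ is the stabilizer of a partition of $\{1,\dots,ab\}$ into $b$ blocks of size $a$; its base group $S_a^b$ has quotient $S_b$, and $\mathrm{Inf}_{S_b}^{S_a\wr S_b}S^\nu$ is $S^\nu$ viewed as an $S_a\wr S_b$-module via this quotient. The generalized Foulkes module is the $S_{ab}$-module $F_\nu^a=\mathrm{Inf}_{S_b}^{S_a\wr S_b}S^\nu\uparrow^{S_{ab}}$ (induced module); in particular $F_\nu^1=S^\nu$, and $F_{(b)}^a$ is the classical Foulkes module. For an $S_k$-module $M$ and an $S_{n-k}$-module $N$, $M\times N$ is the (outer tensor product) $S_k\times S_{n-k}$-module. Concrete model of $F_\nu^a$ ($a,b\ge2$, $n=ab$): let $H=H_b^a$ be the set of ordered partitions $X=(X_1,\dots,X_b)$ of $\{1,\dots,n\}$ into $b$ sets of size $a$; $S_n$ acts on $H$ by permuting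 letters. A $\nu$-tableau $t$ is a bijective filling of the diagram of $\nu$ by $1,\dots,b$; $t_X$ is the diagram of $\nu$ filled by replacing $l$ in $t$ with $X_l$; the ''tabloid'' $\{t_X\}$ is its row-equivalence class. Let $V$ be the $\mathbb{C}$-vector space with formal basis all such ''tabloids'' of shape $\nu$, and let $e_{t_X}=\sum_{\pi\in C_t}\mathrm{sgn}(\pi)\{(\pi t)_X\}\in V$, where $C_t\le S_b$ is the column stabilizer of $t$. $S_n$ acts by $g\{t_X\}=\{t_{gX}\}$, so $g e_{t_X}=e_{t_{gX}}$. The span of $\{e_{t_X}\mid X\in H\}$ (for any fixed $t$) is isomorphic to $F_\nu^a$ and is taken as $F_\nu^a$. The $(1^b)$-summand: let $P_{(1^b)}$ be the set of $X\in H$ such that every $X_i$ contains exactly one element of $\{1,\dots,b\}$. Then $U_{\nu,a}$ is the $S_b\times S_{n-b}$-submodule of $F_\nu^a\downarrow_{S_b\times S_{n-b}}$ generated by (equivalently, spanned by) $\{e_{t_X}\mid X\in P_{(1^b)}\}$ for any $\nu$-tableau $t$, where $S_b=\mathrm{Sym}\{1,\dots,b\}$ and $S_{n-b}=\mathrm{Sym}\{b+1,\dots,n\}$. *)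

(* Defs.v *)
From HB Require Import structures.
From mathcomp Require Import all_boot all_order all_algebra all_fingroup.
From mathcomp Require Import mxrepresentation character.
From mathcomp Require Export reals complex.

Set Implicit Arguments.
Unset Strict Implicit.
Unset Printing Implicit Defensive.

Import GroupScope GRing.Theory.
Local Open Scope ring_scope.

(* The product of permutations is (s * t) i = t (s i) and representations act *)
(* on row vectors from the right, so a right module below is the same thing   *)
(* as a left module over the symmetric group with products read as functions. *)

Section Modules.

Variable K : fieldType.

Section GeneratedSubmodule.

Variables (gT : finGroupType) (G : {group gT}) (n : nat).
Variable rG : mx_representation K G n.
Variables (I : finType) (P : pred I) (v : I -> 'rV[K]_n).

Definition gen_mx : 'M[K]_n := (\sum_(i | P i) cyclic_mx rG (v i))%MS.

Lemma gen_mx_module : mxmodule rG gen_mx.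
Proof. by apply: sumsmx_module => i _; apply: cyclic_mx_module. Qed.

Definition gen_repr : representation K G :=
  Representation (submod_repr gen_mx_module).

Definition quot_repr : representation K G :=
  Representation (factmod_repr gen_mx_module).

End GeneratedSubmodule.

Section PermutationModule.

Variables (gT : finGroupType) (T : finType) (to : {action gT &-> T}).

Definition basis_vec (x : T) : 'rV[K]_#|T| := delta_mx 0 (enum_rank x).

Definition permmod_mx (g : gT) : 'M[K]_#|T| :=
  \matrix_i basis_vec (to (enum_val i) g).

Lemma basis_vec_act x g : basis_vec x *m permmod_mx g = basis_vec (to x g).
Proof. by rewrite -rowE rowK enum_rankK. Qed.

Lemma permmod_mx_repr : mx_repr [set: gT] permmod_mx.
Proof.
split=> [|g h _ _]; apply/row_matrixP=> i; rewrite !rowK.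
  by rewrite act1 /basis_vec enum_valK row1.
by rewrite row_mul rowK basis_vec_act actM.
Qed.

Definition permmod : representation K [set: gT] :=
  Representation (MxRepresentation permmod_mx_repr).

End PermutationModule.

Section Pullback.

Variables (aT rT : finGroupType) (D : {group aT}) (f : {morphism D >-> rT}).

Lemma pullback_subproof : D \subset f @*^-1 [set: rT].
Proof. by rewrite -sub_morphim_pre // subsetT. Qed.

Definition pullback (M : representation K [set: rT]) : representation K D :=
  Representation (subg_repr (morphpre_repr f M) pullback_subproof).

End Pullback.

Definition outer_tensor (gT1 gT2 : finGroupType)
    (M : representation K [set: gT1]) (N : representation K [set: gT2]) :
    representation K [set: gT1 * gT2] :=
  Representation (prod_repr (pullback (fst_morphism gT1 gT2) M)
                            (pullback (snd_morphism gT1 gT2) N)).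

(* M (x)_{KH} KG, as the quotient of M (x)_K KG by the submodule generated by *)
(* the vectors  m h (x) x - m (x) h x  (m in a basis, h in H, x in G).        *)
Section Induction.

Variables (gT : finGroupType) (H : {group gT}) (M : representation K H).

Local Notation G := [set: gT]%G.

Lemma tensor_regular_mx_repr :
  mx_repr G (fun x => tprod (1%:M : 'M_(rdegree M)) (regular_repr K G x)).
Proof.
split=> [|x y Gx Gy]; first by rewrite repr_mx1 tprod1.
by rewrite repr_mxM // -tprodE mulmx1.
Qed.

Definition tensor_regular := MxRepresentation tensor_regular_mx_repr.

Definition pure_tensor (m : 'rV[K]_(rdegree M)) (x : gT) :
    'rV[K]_(rdegree M * gcard G) :=
  tprod m (delta_mx 0 (gring_index G x) : 'rV_(gcard G)).

Definition induced : representation K G :=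
  quot_repr tensor_regular
    [pred u : 'I_(rdegree M) * gT * gT | u.1.2 \in H]
    (fun u => let: (i, h, x) := u in let m := delta_mx 0 i in
       pure_tensor (m *m M h) x - pure_tensor m (h * x)%g).

End Induction.
End Modules.

Definition is_partition (b : nat) (s : seq nat) : bool :=
  [&& sorted geq s, 0%N \notin s & sumn s == b].

(* A partition of b has at most b parts, all at most b: nothing is lost by    *)
(* bounding the length and the entries to get a finite type.                  *)
Definition intpart (b : nat) : finType :=
  {s : b.-bseq 'I_b.+1 | is_partition b (map val s)}.

Definition parts (b : nat) (la : intpart b) : seq nat := map val (val la).

Lemma intpartP b (s : seq nat) :
  reflect (exists la : intpart b, s = parts la) (is_partition b s).
Proof.
apply: (iffP idP) => [sb|[[la Pla] ->] //].
have [_ s0 /eqP sumb] := and3P sb.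
have le_b i : i \in s -> (i < b.+1)%N.
  rewrite -sumb ltnS {sb s0 sumb}; elim: s => //= x s IH.
  rewrite inE => /predU1P[->|/IH]; first exact: leq_addr.
  by move/leq_trans; apply; apply: leq_addl.
have sz : (size s <= b)%N.
  rewrite -sumb {sb le_b sumb}; elim: s s0 => //= x s IH.
  rewrite inE negb_or eq_sym -lt0n => /andP[x0 /IH].
  by rewrite -add1n; apply: leq_add.
pose u : seq 'I_b.+1 := map inord s.
have uE : map val u = s.
  by rewrite -map_comp map_id_in // => i /le_b; apply: inordK.
have szu : (size u <= b)%N by rewrite size_map.
have Pu : is_partition b (map val (Bseq szu)) by rewrite uE.
by exists (Sub (Bseq szu) Pu); rewrite /parts SubK uE.
Qed.

Section Tableaux.

Variables (b : nat) (nu : seq nat).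

(* The box (i, j) lies in row i and column j. *)
Definition diagram : finType := {i : 'I_(size nu) & 'I_(nth 0%N nu i)}.
Definition box_row (d : diagram) : nat := tag d.
Definition box_col (d : diagram) : nat := tagged d.

Definition is_tableau (t : {ffun diagram -> 'I_b}) : bool :=
  [forall l : 'I_b, #|[set d | t d == l]| == 1%N].

Definition col_stab (t : {ffun diagram -> 'I_b}) : {set 'S_b} :=
  [set p : 'S_b | [forall d, forall d',
     (t d' == p (t d)) ==> (box_col d' == box_col d)]].

(* The entries are arbitrary, so that this gives both {t} and {t_X}.          *)
Definition tabloid (E : finType) (u : {ffun diagram -> E}) :
    {set {ffun diagram -> E}} :=
  [set u' | [exists q : {perm diagram},
     [forall d, box_row (q d) == box_row d] && (u' == [ffun d => u (q d)])]].

Section FillingAction.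

Variables (gT : finGroupType) (E : finType) (to : {action gT &-> E}).

Definition fill_act (u : {ffun diagram -> E}) (g : gT) : {ffun diagram -> E} :=
  [ffun d => to (u d) g].

Lemma fill_act1 u : fill_act u 1%g = u.
Proof. by apply/ffunP=> d; rewrite ffunE act1. Qed.

Lemma fill_actM u g h : fill_act u (g * h)%g = fill_act (fill_act u g) h.
Proof. by apply/ffunP=> d; rewrite !ffunE actM. Qed.

Canonical fill_action := TotalAction fill_act1 fill_actM.

Variable K : fieldType.

(* Free on all sets of fillings rather than on tabloids only: just the spans  *)
(* of families of polytabloids are used below.                                *)
Definition tabloid_module : representation K [set: gT] :=
  permmod K (fill_action^*)%act.

(* e_{t_X}; for E = {1,...,b} and X = id this is the usual polytabloid e_t.   *)
Definition polytabloid (t : {ffun diagram -> 'I_b}) (X : {ffun 'I_b -> E}) :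
    'rV[K]_(rdegree tabloid_module) :=
  \sum_(p in col_stab t)
     (-1) ^+ p *: basis_vec K (tabloid [ffun d => X (p (t d))]).

End FillingAction.
End Tableaux.

Lemma row_tableau_exists (b : nat) :
  exists t : {ffun diagram [:: b] -> 'I_b}, is_tableau t.
Proof.
have lt_col (d : diagram [:: b]) : (box_col d < b)%N.
  by case: d => [[[|//] Hi] j]; apply: ltn_ord j.
exists [ffun d => Ordinal (lt_col d)]; apply/forallP=> l; apply/cards1P.
exists (Tagged (fun i : 'I_1 => 'I_(nth 0%N [:: b] i)) (l : 'I_(nth 0%N [:: b] ord0))).
apply/setP=> -[i j]; rewrite !inE ffunE -val_eqE /=.
rewrite (ord1 i) in j *; apply/eqP/eqP => [e|-> //].
by congr Tagged; apply: val_inj.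
Qed.

Section Foulkes.

Variable K : fieldType.

Definition specht (b : nat) (nu : seq nat) : representation K [set: 'S_b] :=
  gen_repr (tabloid_module nu (perm_action 'I_b) K) (@is_tableau b nu)
    (fun t => polytabloid (perm_action 'I_b) K t [ffun l => l]).

Section Wreath.

Variables a b : nat.

Definition block (j : 'I_b) : {set 'I_(a * b)} := [set i : 'I_(a * b) | (i %/ a)%N == j].

Definition wreath : {group 'S_(a * b)} :=
  'N([set block j | j : 'I_b] | 'P^*)%G.

(* The guard only makes this a morphism when a = 0 as well.                   *)
Definition block_perm (s : 'S_(a * b)) : 'S_b :=
  odflt 1%g [pick p : 'S_b | (0 < a)%N && [forall j, s @: block j == block (p j)]].

Lemma block_inj : (0 < a)%N -> injective block.
Proof.
move=> a0 j k jk.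
have lt_ja : (j * a < a * b)%N by rewrite mulnC ltn_pmul2l.
have : Ordinal lt_ja \in block j by rewrite inE /= mulnK.
by rewrite jk inE /= mulnK // => /eqP/val_inj.
Qed.

Lemma block_permE s j : (0 < a)%N -> s \in wreath ->
  s @: block j = block (block_perm s j).
Proof.
move=> a0 sW; rewrite /block_perm.
case: pickP => [p /andP[_ /forallP/(_ j)/eqP //]|/= noP].
have im k : {k' | s @: block k == block k'}.
  apply: sigW; have : block k \in [set block j | j : 'I_b] by apply: imset_f.
  by rewrite -(astabs_act _ sW) => /imsetP[k' _ e]; exists k'; rewrite -e.
have inj_f : injective (fun k => sval (im k)).
  move=> k k' /(congr1 block).
  rewrite -(eqP (svalP (im k))) -(eqP (svalP (im k'))) => /(imset_inj perm_inj).
  exact: block_inj.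
have /negP[] := negbT (noP (perm inj_f)); rewrite a0 /=.
by apply/forallP=> k; rewrite permE; apply: (svalP (im k)).
Qed.

Lemma block_permM : {in wreath &, {morph block_perm : s s' / (s * s')%g}}.
Proof.
move=> s s' sW s'W; have [a0|a0] := posnP a.
  have E s0 : block_perm s0 = 1%g.
    by rewrite /block_perm; case: pickP => // p /andP[]; rewrite {1}a0.
  by rewrite !E mulg1.
apply/permP=> j; rewrite permM; apply: block_inj => //.
rewrite -!block_permE ?groupM // -imset_comp.
by apply: eq_imset => i; rewrite /= permM.
Qed.

Canonical block_perm_morphism := Morphism block_permM.

Definition foulkes (nu : seq nat) : representation K [set: 'S_(a * b)] :=
  induced (pullback block_perm_morphism (specht b nu)).

End Wreath.

(* The concrete model, on n letters; H is empty unless n = a b.               *)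
Section Model.

Variables (nu : seq nat) (a b n : nat).

Definition ordered_set_partitions : {set {ffun 'I_b -> {set 'I_n}}} :=
  [set X : {ffun 'I_b -> {set 'I_n}} |
     [&& [forall l, #|X l| == a],
         [forall l, forall l', (l != l') ==> [disjoint X l & X l']]
       & \bigcup_l X l == setT]].

Definition foulkes_ambient : representation K [set: 'S_n] :=
  tabloid_module nu ('P^*)%act K.

Definition block_polytabloid (t : {ffun diagram nu -> 'I_b})
    (X : {ffun 'I_b -> {set 'I_n}}) : 'rV[K]_(rdegree foulkes_ambient) :=
  polytabloid ('P^*)%act K t X.

Definition foulkes_model_mx (t : {ffun diagram nu -> 'I_b}) :=
  gen_mx foulkes_ambient (mem ordered_set_partitions) (block_polytabloid t).

End Model.

(* The n letters are 'I_(b + m) with m = n - b; the left summand is {1,...,b},*)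
(* the right one is {b+1,...,n}, and S_b x S_{n-b} is embedded accordingly.   *)
Section Summand.

Variables (b m : nat).

Definition young_fun (g : 'S_b * 'S_m) (i : 'I_(b + m)) : 'I_(b + m) :=
  unsplit (match split i with inl j => inl (g.1 j) | inr k => inr (g.2 k) end).

Lemma young_fun_inj g : injective (young_fun g).
Proof.
move=> i i' /(can_inj (@unsplitK b m)) e; apply: (can_inj (@splitK b m)).
by case: (split i) (split i') e => [j|k] [j'|k'] // [] /perm_inj->.
Qed.

Definition young_perm (g : 'S_b * 'S_m) : 'S_(b + m) := perm (@young_fun_inj g).

Lemma young_permM :
  {in [set: 'S_b * 'S_m] &, {morph young_perm : g h / (g * h)%g}}.
Proof.
move=> g h _ _; apply/permP=> i; rewrite permM !permE /young_fun unsplitK.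
by case: (split i) => j; rewrite permM.
Qed.

Canonical young_morphism := Morphism young_permM.

Variables (nu : seq nat) (a : nat).

Definition transversal_partitions : {set {ffun 'I_b -> {set 'I_(b + m)}}} :=
  [set X in ordered_set_partitions a b (b + m) |
     [forall l, #|X l :&: [set lshift m i | i : 'I_b]| == 1%N]].

Definition summand_mx (t : {ffun diagram nu -> 'I_b}) :=
  gen_mx (pullback young_morphism (foulkes_ambient nu (b + m)))
    (mem transversal_partitions) (block_polytabloid t).

(* U_{nu,a}: being contained in the model of F_nu^a (summand_sub below), it   *)
(* can be generated inside the ambient module of all tabloids.                *)
Definition summand (t : {ffun diagram nu -> 'I_b}) :
    representation K [set: 'S_b * 'S_m] :=
  gen_repr (pullback young_morphism (foulkes_ambient nu (b + m)))
    (mem transversal_partitions) (block_polytabloid t).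

Lemma summand_sub t : (summand_mx t <= foulkes_model_mx a (b + m) t)%MS.
Proof.
apply/sumsmx_subP=> X /setIdP[XH _].
apply: cyclic_mx_sub.
  apply/mxmoduleP=> g _.
  exact: (mxmoduleP (gen_mx_module _ _ _)) (young_perm g) (in_setT _).
by apply: submx_trans (sumsmx_sup X _ (submx_refl _)) => //; apply: cyclic_mx_id.
Qed.

End Summand.
End Foulkes.

(* Main.v *)
Require Import Defs.
From mathcomp Require Import all_boot all_order all_algebra all_fingroup.
From mathcomp Require Import pgroup mxrepresentation character.
From mathcomp Require Import reals complex.

(* Splitting off the letters 1..b, the unordered set partitions spanning     *)
(* U_{(b),a} are the sets {{l} u x(Y_(q l)) | l <= b} for q in S_b and x in   *)
(* S_{n-b}, where Y is a fixed ordered partition of {b+1..n} into b sets of   *)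
(* size a-1: so U is the bimodule C[S_b] induced from S_b x (S_{a-1} wr S_b)  *)
(* to S_b x S_{n-b}. Each S^la is self-dual, so its matrix coefficients give  *)
(* a map S^la x S^la -> C[S_b], hence by Frobenius reciprocity a map          *)
(* S^la x F_la^{a-1} -> U. Together these maps are onto, since no nonzero     *)
(* element of C[S_b] acts as zero on all Specht modules, and the dimensions   *)
(* agree because the squares of the dimensions of the S^la sum to at most b!. *)
(* That the S^la are irreducible, pairwise non-isomorphic and exhaust the     *)
(* irreducibles is James' argument with column symmetrizers, plus the fact    *)
(* that S_b has at most as many conjugacy classes as there are partitions.    *)

Set Implicit Arguments.
Unset Strict Implicit.
Unset Printing Implicit Defensive.

Import GroupScope GRing.Theory.
Local Open Scope ring_scope.

(** * Cycle types *)

(** Conceptually, the span of the vectors [omega q] is the bimodule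
    $\mathbb{C}[S_b]\cong\bigoplus_\lambda S^\lambda\otimes S^\lambda$; its right action is inflated
    to the stabilizer $H$ of a block system on the remaining $m$ letters and then induced to $S_m$,
    and the decomposition survives both operations. The proof squeezes dimensions instead of
    transporting that isomorphism. For each $\lambda$, [coef_mx] and [surjects_onto_outer_induced]
    give an intertwiner from $S^\lambda\times F_\lambda$ into the tabloid module, with image inside
    $U$. By [omega_in_coef] these maps are jointly onto $U$. By [rank_summand], $\dim U\ge
    b!\,[S_m:H]$, while [rdegree_induced_le] and [specht_sum_degree] bound the dimension of the
    direct sum by the same number, so [surjects_onto_rsim] applies. Three facts on Specht modules
    enter: [specht_faithful], [specht_sum_degree] and [specht_parts_selfdual]. They rest on
    [specht_irreducible], on the dominance argument [specht_rsim_dominates], which separates the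
    shapes, and on [card_classes_Sym], which makes the family complete. [summand_rsim] is proved for
    an abstract stabilizer $H$ with block action [phi]. The two halves of the result are instances:
    the wreath product permuting the sets [block], and all of $S_b$ permuting singletons. *)

Section CycleType.

Variable T : finType.
Implicit Type s : {perm T}.

Definition cycle_reps s : seq T :=
  sort (fun x y => geq (fingraph.order s x) (fingraph.order s y)) (enum (froots s)).

Definition cycle_type s : seq nat := map (fingraph.order s) (cycle_reps s).

Definition cycle_listing s : seq T := flatten (map (fingraph.orbit s) (cycle_reps s)).

Lemma mem_cycle_reps s x : (x \in cycle_reps s) = (froots s x).
Proof. by rewrite mem_sort mem_enum. Qed.

Lemma mem_cycle_listing s x : x \in cycle_listing s.
Proof.
have symf := fconnect_sym (@perm_inj _ s).
apply/flatten_mapP; exists (froot s x); first by rewrite mem_cycle_reps roots_root.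
by rewrite -fconnect_orbit symf connect_root.
Qed.

Lemma cycle_listing_uniq s : uniq (cycle_listing s).
Proof.
have symf := fconnect_sym (@perm_inj _ s).
have rootsE x : x \in cycle_reps s -> froot s x = x.
  by rewrite mem_cycle_reps => /eqP.
have : uniq (cycle_reps s) by rewrite sort_uniq enum_uniq.
rewrite /cycle_listing; elim: (cycle_reps s) rootsE => //= x r IH rE.
case/andP=> xr ur; rewrite cat_uniq orbit_uniq IH ?andbT //; last first.
  by move=> y yr; apply: rE; rewrite inE yr orbT.
apply/hasPn=> y /flatten_mapP[z zr]; rewrite -!fconnect_orbit => zy.
apply: contra xr => xy; suff -> : x = z by [].
rewrite -(rE x) ?mem_head // -(rE z); last by rewrite inE zr orbT.
by apply/eqP; rewrite root_connect //; apply: connect_trans xy _; rewrite symf.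
Qed.

Lemma size_cycle_listing s : size (cycle_listing s) = #|T|.
Proof.
rewrite -(card_uniqP (cycle_listing_uniq s)).
by apply: eq_card => x; rewrite mem_cycle_listing inE.
Qed.

Lemma shape_cycle_listing s : shape (map (fingraph.orbit s) (cycle_reps s)) =
  cycle_type s.
Proof. by rewrite /shape -map_comp; apply: eq_map => x /=; rewrite size_orbit. Qed.

Lemma cycle_type_partition s : is_partition #|T| (cycle_type s).
Proof.
apply/and3P; split.
- rewrite sorted_map; apply: sort_sorted => x y; exact: leq_total.
- by apply/mapP=> -[x _ e]; have := fingraph.order_gt0 s x; rewrite -e.
- by rewrite -shape_cycle_listing -size_flatten size_cycle_listing.
Qed.

(** What a permutation does to its own cycle listing: a positional operation that depends only on
    the cycle type. *)
Definition rotate_blocks (A : Type) (sh : seq nat) (r : seq A) : seq A :=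
  flatten (map (rot 1) (reshape sh r)).

Lemma rotate_blocks_map (A B : Type) (g : A -> B) sh r :
  rotate_blocks sh (map g r) = map g (rotate_blocks sh r).
Proof.
rewrite /rotate_blocks -map_reshape map_flatten; congr flatten.
by rewrite -!map_comp; apply: eq_map => r' /=; rewrite map_rot.
Qed.

Lemma map_orbit_rot s x : map s (fingraph.orbit s x) = rot 1 (fingraph.orbit s x).
Proof.
have map_traj k y : map s (traject s y k) = traject s (s y) k.
  by elim: k y => //= k IH y; rewrite IH.
have := fingraph.order_gt0 s x; rewrite /fingraph.orbit.
case e: (fingraph.order s x) => [//|n] _; rewrite map_traj [in RHS]trajectS rot1_cons.
by rewrite trajectSr -iterSr -e (iter_order (@perm_inj _ s)).
Qed.

Lemma map_cycle_listing s :
  map s (cycle_listing s) = rotate_blocks (cycle_type s) (cycle_listing s).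
Proof.
rewrite /rotate_blocks -shape_cycle_listing flattenK map_flatten -!map_comp.
by congr flatten; apply: eq_map => x /=; apply: map_orbit_rot.
Qed.

(** Matching the two cycle listings position by position gives the conjugator, because both
    permutations act on their listings by the same rotation of blocks ([map_cycle_listing]). *)
Lemma cycle_type_conj s s' : cycle_type s = cycle_type s' -> exists g, s' = (s ^ g)%g.
Proof.
move=> st; pose L := cycle_listing s; pose L' := cycle_listing s'.
have szL : size L = size L' by rewrite !size_cycle_listing.
have iL x : (index x L < size L)%N by rewrite index_mem mem_cycle_listing.
pose f x := nth x L' (index x L).
have inj_f : injective f.
  move=> x y; rewrite /f (set_nth_default y) -?szL // => /eqP.
  rewrite nth_uniq -?szL ?cycle_listing_uniq // => /eqP e.
  by rewrite -(nth_index x (mem_cycle_listing s x)) e nth_index ?mem_cycle_listing.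
pose g := perm inj_f; exists g.
have LE : L' = map g L.
  case: (posnP (size L)) => [L0|].
    by move/esym: szL; rewrite L0 => /size0nil ->; move/size0nil: L0 => ->.
  case EL: {1}L => [//|x0 r] _; clear r EL.
  apply: (@eq_from_nth _ x0) => [|i]; rewrite ?size_map // => iL'.
  rewrite -szL in iL'; rewrite (nth_map x0) // permE /f index_uniq ?cycle_listing_uniq
    //.
  by apply: set_nth_default; rewrite -szL.
have : map s' L' = map g (map s L).
  by rewrite !map_cycle_listing -st -/L' LE rotate_blocks_map.
rewrite LE -!map_comp => /eq_in_map E.
apply/permP=> y; rewrite /conjg !permM -{1}(permKV g y).
exact: (E _ (mem_cycle_listing s _)).
Qed.

End CycleType.

(** The cycle type of a representative separates classes. This bound is what forces the Specht
    modules to exhaust the irreducibles. *)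
Lemma card_classes_Sym (b : nat) : (#|classes [set: 'S_b]| <= #|intpart b|)%N.
Proof.
have ct (s : 'S_b) : {la : intpart b | cycle_type s == parts la}.
  apply: sigW; have := cycle_type_partition s; rewrite card_ord.
  by case/intpartP=> la e; exists la; apply/eqP.
pose f (A : {set 'S_b}) := sval (ct (repr A)).
rewrite -(card_in_imset (f := f)) ?max_card // => _ _ /imsetP[x _ ->] /imsetP[y _ ->].
rewrite /f; have [u _ ->] := repr_class [set: 'S_b] x.
have [v _ ->] := repr_class [set: 'S_b] y => e.
have := svalP (ct (x ^ u)%g); rewrite e -(eqP (svalP (ct (y ^ v)%g))).
move/eqP/cycle_type_conj => [g E].
have xG z w : (w ^: [set: 'S_b] = (w ^ z) ^: [set: 'S_b])%g by rewrite classGidl ?inE.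
by rewrite (xG v y) E -!xG.
Qed.

(** * Families of irreducible representations *)

Section CompleteFamily.

Variables (K : closedFieldType) (gT : finGroupType) (G : {group gT}).
Hypothesis char0 : [pchar K] =i pred0.
Variables (I : finType) (V : I -> representation K G).
Hypothesis irrV : forall i, mx_irreducible (V i).
Hypothesis nisoV : forall i j, mx_rsim (V i) (V j) -> i = j.
Hypothesis leGI : (#|classes G| <= #|I|)%N.

Let sG : irrType K G := DecSocleType (regular_repr K G).
Let char'G : [pchar K]^'.-group G.
Proof. by rewrite /pgroup pcharf'_nat (proj1 (pcharf0P _) char0) -lt0n cardG_gt0. Qed.
Let splitG : group_splitting_field K G := @group_closure_closed_field K gT G.
Let comp i := irr_comp sG (V i).

Let rsim_comp i : mx_rsim (V i) (irr_repr (comp i)).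
Proof. exact: rsim_irr_comp_pchar. Qed.

Let comp_inj : injective comp.
Proof.
move=> i j e; apply: nisoV; apply: mx_rsim_trans (rsim_comp i) _.
by rewrite e; apply/mx_rsim_sym/rsim_comp.
Qed.

Lemma sum_degree_le : (\sum_i rdegree (V i) ^ 2 <= #|G|)%N.
Proof.
have <- := sum_irr_degree_pchar sG char'G splitG.
have -> : (\sum_i rdegree (V i) ^ 2 = \sum_(W in comp @: I) irr_degree W ^ 2)%N.
  rewrite big_imset /=; last by move=> i j _ _; apply: comp_inj.
  by apply: eq_bigr => i _; rewrite (mxrank_rsim (rsim_comp i)).
by rewrite [X in (_ <= X)%N](bigID (mem (comp @: I))) /= leq_addr.
Qed.

(** The element $\sum_x c(x)x$ of the group algebra acts as zero on every irreducible, so each of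
    its Wedderburn components vanishes, hence so does the element and each coefficient. *)
Lemma irr_family_faithful (c : gT -> K) :
  (forall i, \sum_(x in G) c x *: V i x = 0) -> {in G, forall x, c x = 0}.
Proof.
move=> c0 x Gx.
pose A := \sum_(x in G) c x *: regular_repr K G x.
have opA n (rG : mx_representation K G n) : gring_op rG A = \sum_(x in G) c x *: rG x.
  rewrite linear_sum /=; apply: eq_bigr => y Gy.
  by rewrite linearZ /= gring_opG.
have opW (W : sG) : gring_op (irr_repr W) A = 0.
  (* There are as many irreducibles as classes, hence at most $|I|$, so the injection [comp] is
     onto. *)
  have /imageP[i _ ->] : W \in codom comp.
    by apply: (inj_card_onto comp_inj); rewrite (card_irr_pchar sG char'G splitG).
  have [B [B' _ hB]] := mx_rsim_def (mx_rsim_sym (rsim_comp i)).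
  rewrite opA (eq_bigr (fun y => B *m (c y *: V i y) *m B')); last first.
    by move=> y Gy; rewrite hB // -scalemxAr -scalemxAl.
  by rewrite -mulmx_suml -mulmx_sumr c0 mulmx0 mul0mx.
have A0 : A = 0.
  have : (A \in group_ring K G)%MS by apply/envelop_mxP; exists c.
  rewrite -(Wedderburn_sum_pchar sG char'G) => /memmx_sumsP[A_ defA RA]; rewrite defA.
  rewrite big1 // => W _; have irrW := socle_irr W.
  apply: (regular_op_inj_pchar (sG := sG) char'G irrW).
  - by rewrite inE /= [irr_comp _ _](irr_reprK_pchar char'G).
  - by rewrite inE linear0 sub0mx.
  have := opW W; rewrite defA linear_sum (bigD1 W) //= big1 ?addr0 ?linear0 //.
  by move=> W' W'W; apply: (irr_repr'_op0_pchar char'G W'W).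
have := congr1 (@gring_proj K gT G x) A0.
rewrite linear_sum linear0 (bigD1 x) //= linearZ /= gring_projE // eqxx.
rewrite big1 ?addr0 => [/rowP/(_ 0)|y /andP[Gy yx]]; last first.
  by rewrite linearZ /= gring_projE // eq_sym (negPf yx) (_ : false%:R = 0) ?scaler0.
by rewrite !mxE mulr1.
Qed.

End CompleteFamily.

(** * Surjections, tensor products and induction *)

Section Surjections.

Variables (K : fieldType) (gT : finGroupType) (G : {group gT}).

(** The image is kept as a subspace of a fixed ambient [W], so that images of several maps can
    simply be added. *)
Definition surjects_onto n1 (V : mx_representation K G n1)
    n2 (W : mx_representation K G n2) (S : 'M_n2) : Prop :=
  exists2 B : 'M_(n1, n2),
    forall g, g \in G -> V g *m B = B *m W g & (B :=: S)%MS.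

Lemma surjects_onto_dadd (V1 V2 : representation K G) n
    (W : mx_representation K G n) (S1 S2 : 'M_n) :
  surjects_onto V1 W S1 -> surjects_onto V2 W S2 ->
  surjects_onto (dadd_grepr V1 V2) W (S1 + S2)%MS.
Proof.
case=> B1 h1 e1 [B2 h2 e2]; exists (col_mx B1 B2).
  by move=> g Gg; rewrite mul_block_col !mul0mx addr0 add0r mul_col_mx h1 ?h2.
exact: eqmx_trans (eqmx_sym (addsmxE _ _)) (adds_eqmx e1 e2).
Qed.

Lemma surjects_onto_dsum (I : finType) (V : I -> representation K G) n
    (W : mx_representation K G n) (S : I -> 'M_n) :
  (forall i, surjects_onto (V i) W (S i)) ->
  surjects_onto (\big[dadd_grepr/grepr0]_i V i) W (\sum_i S i)%MS.
Proof.
move=> sur; elim/big_ind2: _ => // [|V1 S1 V2 S2]; last exact: surjects_onto_dadd.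
by exists 0 => [g _|]; rewrite ?mulmx0 ?mul0mx //; apply/eqmxP; rewrite !sub0mx.
Qed.

Lemma rdegree_dsum (I : finType) (V : I -> representation K G) :
  rdegree (\big[dadd_grepr/grepr0]_i V i) = (\sum_i rdegree (V i))%N.
Proof. exact: (big_morph (@rdegree K gT G)). Qed.

(** A surjection whose source is no larger than its image is bijective; the dimension count thus
    replaces the construction of an inverse. *)
Lemma surjects_onto_rsim n1 (V : mx_representation K G n1)
    n2 (W : mx_representation K G n2) (S : 'M_n2) (modS : mxmodule W S) :
  surjects_onto V W S -> (n1 <= \rank S)%N -> mx_rsim V (submod_repr modS).
Proof.
case=> B hB eBS leS.
have BS : (B <= S)%MS by rewrite eBS.
have rB : \rank B = \rank S by rewrite eBS.
have n1E : n1 = \rank S by apply/eqP; rewrite eqn_leq leS -rB rank_leq_row.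
exists (in_submod S B) => // [|g Gg].
  by rewrite /row_free mxrank_in_submod // rB n1E.
by apply: etrans (in_submodJ modS g BS); rewrite -hB // in_submodE [in RHS]in_submodE
  mulmxA.
Qed.

End Surjections.

Section TensorHom.

Variable K : fieldType.

Lemma tprodDl m1 n1 m2 n2 (A A' : 'M[K]_(m1, n1)) (B : 'M_(m2, n2)) :
  tprod (A + A') B = tprod A B + tprod A' B.
Proof.
elim: m1 A A' => [|m1 IH] A A' /=; first by rewrite addr0.
by rewrite !linearD /= IH -!trowbE linearD add_col_mx.
Qed.

Lemma tprodDr m1 n1 m2 n2 (A : 'M[K]_(m1, n1)) (B B' : 'M_(m2, n2)) :
  tprod A (B + B') = tprod A B + tprod A B'.
Proof.
elim: m1 A => [|m1 IH] A /=; first by rewrite addr0.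
by rewrite IH linearD add_col_mx.
Qed.

Lemma tprod0l m1 n1 m2 n2 (B : 'M[K]_(m2, n2)) : tprod (0 : 'M_(m1, n1)) B = 0.
Proof. by apply: (addrI (tprod 0 B)); rewrite -tprodDl !addr0. Qed.

Lemma tprod0r m1 n1 m2 n2 (A : 'M[K]_(m1, n1)) : tprod A (0 : 'M_(m2, n2)) = 0.
Proof. by apply: (addrI (tprod A 0)); rewrite -tprodDr !addr0. Qed.

Definition tprod_suml m1 n1 m2 n2 (B : 'M[K]_(m2, n2)) :=
  big_morph (fun A : 'M_(m1, n1) => tprod A B) (fun A A' => tprodDl A A' B)
            (tprod0l m1 n1 B).
Definition tprod_sumr m1 n1 m2 n2 (A : 'M[K]_(m1, n1)) :=
  big_morph (fun B : 'M_(m2, n2) => tprod A B) (tprodDr A) (tprod0r m2 n2 A).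

Lemma tprod_scalar11 (a b : K) :
  tprod (a%:M : 'M_1) (b%:M : 'M_1) = (a * b)%:M :> 'M_1.
Proof.
apply/matrixP=> i j; rewrite !ord1 /= mxE.
case: splitP => // i' _; rewrite mxE; case: splitP => // j' _.
by rewrite !mxE !ord1 /= !mulr1n.
Qed.

Lemma mx1_sum_delta n :
  1%:M = \sum_(i < n) (delta_mx i 0 : 'cV[K]_n) *m (delta_mx 0 i : 'rV_n).
Proof.
rewrite {1}(matrix_sum_delta 1%:M); apply: eq_bigr => i _.
rewrite (bigD1 i) //= mxE eqxx scale1r mul_delta_mx big1 ?addr0 // => j ji.
by rewrite mxE eq_sym (negPf ji) scale0r.
Qed.

Lemma tensor_submx m n p q (X : 'M[K]_(m * n, q)) (S : 'M_(p, q)) :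
  (forall i j, (tprod (delta_mx 0 i : 'rV_m) (delta_mx 0 j : 'rV_n) *m X <= S)%MS) ->
  (X <= S)%MS.
Proof.
move=> XS; rewrite -[X]mul1mx -tprod1 {1}mx1_sum_delta tprod_suml mulmx_suml.
apply: summx_sub => i _; rewrite mx1_sum_delta tprod_sumr mulmx_suml.
apply: summx_sub => j _; rewrite tprodE -mulmxA.
by apply: submx_trans (submxMl _ _) (XS i j).
Qed.

Lemma eq_mx_tensor m n q (X Y : 'M[K]_(m * n, q)) :
  (forall i j, tprod (delta_mx 0 i : 'rV_m) (delta_mx 0 j : 'rV_n) *m X =
               tprod (delta_mx 0 i : 'rV_m) (delta_mx 0 j : 'rV_n) *m Y) ->
  X = Y.
Proof.
move=> eXY; apply/eqP; rewrite -subr_eq0 -submx0; apply: tensor_submx => i j.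
by rewrite mulmxBr eXY subrr sub0mx.
Qed.

(** The map $e_i\otimes e_j\mapsto e_j f_i$: a linear map out of a tensor product is given by a
    family of maps on the second factor, indexed by a basis of the first. *)
Definition tensor_hom m n q (f : 'I_m -> 'M[K]_(n, q)) : 'M[K]_(m * n, q) :=
  \sum_i \sum_j
    (tprod (delta_mx i 0 : 'cV_m) (delta_mx j 0 : 'cV_n) : 'cV_(m * n))
      *m row j (f i).

Lemma tensor_homE m n q (f : 'I_m -> 'M[K]_(n, q)) (u : 'rV_m) (v : 'rV_n) :
  (tprod u v : 'rV_(m * n)) *m tensor_hom f = v *m \sum_i u 0 i *: f i.
Proof.
rewrite !mulmx_sumr; apply: eq_bigr => i _.
rewrite mulmx_sumr -scalemxAr [v *m f i]mulmx_sum_row scaler_sumr.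
apply: eq_bigr => j _; rewrite mulmxA.
have -> : (tprod u v : 'rV_(m * n)) *m
    (tprod (delta_mx i 0 : 'cV_m) (delta_mx j 0 : 'cV_n) : 'cV_(m * n))
    = (u 0 i * v 0 j)%:M.
  rewrite -(tprodE u (delta_mx i 0 : 'cV_m) v (delta_mx j 0 : 'cV_n)) -!colE.
  by rewrite [col i u]mx11_scalar [col j v]mx11_scalar !mxE tprod_scalar11.
by rewrite mul_scalar_mx scalerA.
Qed.

Lemma tensor_hom_delta m n q (f : 'I_m -> 'M[K]_(n, q)) i j :
  (tprod (delta_mx 0 i : 'rV_m) (delta_mx 0 j : 'rV_n) : 'rV_(m * n))
    *m tensor_hom f = row j (f i).
Proof.
rewrite tensor_homE (bigD1 i) //= mxE !eqxx scale1r big1 ?addr0 -?rowE //.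
by move=> k ki; rewrite mxE (negPf ki) andbF scale0r.
Qed.

Lemma tensor_hom_eqmx m n q (f : 'I_m -> 'M[K]_(n, q)) :
  (tensor_hom f :=: \sum_i <<f i>>)%MS.
Proof.
apply/eqmxP/andP; split.
  apply: tensor_submx => i j; rewrite tensor_hom_delta.
  by apply: submx_trans (row_sub j _) _; rewrite (sumsmx_sup i) ?genmxE.
apply/sumsmx_subP=> i _; rewrite genmxE; apply/row_subP=> j.
by rewrite -tensor_hom_delta submxMl.
Qed.

End TensorHom.

Section OuterTensor.

Variables (K : fieldType) (gT1 gT2 : finGroupType).
Variables (M : representation K [set: gT1]) (N : representation K [set: gT2]).

Lemma surjects_onto_outer n (W : mx_representation K [set: gT1 * gT2] n)
    (f : 'I_(rdegree M) -> 'M[K]_(rdegree N, n)) :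
  (forall g h i, N h *m (\sum_k M g i k *: f k) = f i *m W (g, h)) ->
  surjects_onto (outer_tensor M N) W (\sum_i <<f i>>)%MS.
Proof.
move=> hf; exists (tensor_hom f); last exact: tensor_hom_eqmx.
move=> [g h] _; apply: eq_mx_tensor => i j; rewrite mulmxA [RHS]mulmxA.
rewrite tensor_hom_delta -row_mul -hf row_mul.
rewrite -[tprod _ _ *m _](tprodE (delta_mx 0 i) (M g) (delta_mx 0 j) (N h)).
rewrite -!rowE [LHS]tensor_homE; congr (_ *m _).
by apply: eq_bigr => k _; rewrite mxE.
Qed.

Lemma outer_tensor_rsim (N' : representation K [set: gT2]) :
  mx_rsim N N' -> mx_rsim (outer_tensor M N) (outer_tensor M N').
Proof.
case=> B eN; rewrite /row_free => rB hB.
exists (tprod 1%:M B) => [||[g h] _].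
- by rewrite /= eN.
- have /row_freeP[B' BB'] : row_free B by [].
  by apply/row_freeP; exists (tprod 1%:M B'); rewrite -tprodE BB' mulmx1 tprod1.
by rewrite -[LHS]tprodE -[RHS]tprodE mulmx1 mul1mx hB ?inE.
Qed.

End OuterTensor.

(** * Induced modules and Frobenius reciprocity *)

Section InducedHom.

Variables (K : fieldType) (gT : finGroupType) (H : {group gT}).
Variable M : representation K H.

Local Notation G := [set: gT]%G.
Local Notation ind_rel := (gen_mx (tensor_regular M)
    [pred u : 'I_(rdegree M) * gT * gT | u.1.2 \in H]
    (fun u => let: (i, h, x) := u in let m := delta_mx 0 i in
       pure_tensor (m *m M h) x - pure_tensor m (h * x)%g)).

Definition ind_vec (m : 'rV[K]_(rdegree M)) (x : gT) : 'rV_(rdegree (induced M)) :=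
  in_factmod ind_rel (pure_tensor m x).

Lemma ind_vec_mul i h x : h \in H ->
  ind_vec (delta_mx 0 i *m M h) x = ind_vec (delta_mx 0 i) (h * x)%g.
Proof.
move=> hH; apply/eqP; rewrite -subr_eq0 -linearB in_factmod_eq0.
by rewrite (sumsmx_sup (i, h, x)) // cyclic_mx_id.
Qed.

Lemma ind_vec_submx p q (X : 'M_(rdegree (induced M), q)) (S : 'M_(p, q)) :
  (forall i x, (ind_vec (delta_mx 0 i) x *m X <= S)%MS) -> (X <= S)%MS.
Proof.
move=> XS; rewrite -[X]mul1mx -(val_factmodK 1%:M) in_factmodE -mulmxA.
apply: submx_trans (submxMl _ _) _; apply: tensor_submx => i k.
rewrite mulmxA -in_factmodE; have := XS i (enum_val k).
by rewrite /ind_vec /pure_tensor gring_valK.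
Qed.

Lemma eq_mx_induced q (X Y : 'M_(rdegree (induced M), q)) :
  (forall i x, ind_vec (delta_mx 0 i) x *m X = ind_vec (delta_mx 0 i) x *m Y) ->
  X = Y.
Proof.
move=> eXY; apply/eqP; rewrite -subr_eq0 -submx0; apply: ind_vec_submx => i x.
by rewrite mulmxBr eXY subrr sub0mx.
Qed.

(** One copy of $M$ for each right coset of $H$ spans the induced module. *)
Lemma rdegree_induced_le :
  (rdegree (induced M) <= rdegree M * #|[set: gT] : H|)%N.
Proof.
pose P (A : {set gT}) := in_factmod ind_rel
  (tprod (1%:M : 'M_(rdegree M)) (delta_mx 0 (gring_index G (repr A)) : 'rV_(gcard G))).
have sub1 : ((1%:M : 'M_(rdegree (induced M))) <= \sum_(A in rcosets H [set: gT]) <<P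
  A>>)%MS.
  apply: ind_vec_submx => i x; rewrite mulmx1.
  (* The chosen representative of $Hx$ is $hx$, and $m\otimes x=mh^{-1}\otimes hx$. *)
  have /rcosetP[h hH ex] := mem_repr_rcoset H x.
  have -> : ind_vec (delta_mx 0 i) x
      = ind_vec (delta_mx 0 i *m M h^-1%g) (repr (H :* x)).
    by rewrite ind_vec_mul ?groupV // ex mulKg.
  apply: submx_trans (_ : (_ <= <<P (H :* x)%g>>)%MS) _; last first.
    by rewrite (sumsmx_sup (H :* x)%g) //; apply/rcosetsP; exists x; rewrite ?inE.
  rewrite genmxE /P /ind_vec /pure_tensor.
  set m := _ *m M _; set e := delta_mx 0 (gring_index _ _).
  have -> : (tprod m e : 'rV_(rdegree M * gcard G)) =
     tprod m (1%:M : 'M_1) *m tprod (1%:M : 'M_(rdegree M)) e.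
    by rewrite -tprodE mulmx1 mul1mx.
  by rewrite in_factmodE -mulmxA -in_factmodE submxMl.
have := mxrankS sub1; rewrite mxrank1 => /leq_trans; apply.
rewrite /indexg -sum1_card big_distrr /=.
apply: leq_trans (mxrank_sum_leqif _).1 _ => /=.
by apply: leq_sum => A _; rewrite genmxE rank_leq_row.
Qed.

Variables (n : nat) (W : mx_representation K G n).
Variable f : 'M[K]_(rdegree M, n).
Hypothesis hf : forall h, h \in H -> M h *m f = f *m W h.

Let th := tensor_hom (fun i => \matrix_(k < gcard G) (row i f *m W (enum_val k))).

Let thE m x : pure_tensor m x *m th = m *m f *m W x.
Proof.
rewrite /pure_tensor tensor_homE -rowE linear_sum /= [m *m f]mulmx_sum_row mulmx_suml.
apply: eq_bigr => i _; rewrite linearZ /= rowK gring_indexK ?inE //.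
by rewrite -scalemxAl.
Qed.

Let thJ x : tensor_regular M x *m th = th *m W x.
Proof.
apply: eq_mx_tensor => i k; rewrite !mulmxA.
rewrite -[tprod _ _ *m _]tprodE mulmx1 -rowE rowK -(gring_valK k).
rewrite gring_indexK ?enum_valP //.
by rewrite [LHS](thE _ _) [in RHS](thE _ _) -mulmxA repr_mxM ?inE // !mulmxA.
Qed.

(** The adjoint $m\otimes x\mapsto m f x$ of the $H$-map [f]. Taking representatives with
    [val_factmod] is harmless because [th] kills the defining relations ([ker_th]). *)
Definition frobenius : 'M[K]_(rdegree (induced M), n) := val_factmod 1%:M *m th.

Let ker_th : (ind_rel <= kermx th)%MS.
Proof.
apply/sumsmx_subP=> -[[i h] x] hH; apply: cyclic_mx_sub.
  apply/mxmoduleP=> y _; apply/sub_kermxP.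
  by rewrite -mulmxA thJ mulmxA mulmx_ker mul0mx.
apply/sub_kermxP; rewrite mulmxBl !thE repr_mxM ?inE //.
by rewrite -!mulmxA [M h *m _]mulmxA hf // !mulmxA subrr.
Qed.

Let in_frobenius p (X : 'M_(p, _)) : in_factmod ind_rel X *m frobenius = X *m th.
Proof.
rewrite -{2}[X](add_sub_fact_mod ind_rel) mulmxDl.
rewrite (sub_kermxP (submx_trans (val_submodP _) ker_th)) add0r.
by rewrite mulmxA -val_factmodE.
Qed.

Lemma frobeniusE m x : ind_vec m x *m frobenius = m *m f *m W x.
Proof. by rewrite in_frobenius thE. Qed.

Lemma frobeniusJ x : induced M x *m frobenius = frobenius *m W x.
Proof. by rewrite [LHS]in_frobenius -mulmxA thJ mulmxA. Qed.

Lemma frobenius_eqmx : (frobenius :=: \sum_x <<f *m W x>>)%MS.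
Proof.
apply/eqmxP/andP; split.
  apply: ind_vec_submx => i x; rewrite frobeniusE -mulmxA.
  by apply: submx_trans (submxMl _ _) _; rewrite (sumsmx_sup x) ?genmxE.
apply/sumsmx_subP=> x _; rewrite genmxE; apply/row_subP=> i.
by rewrite rowE mulmxA -frobeniusE submxMl.
Qed.

End InducedHom.

(** Each [f i] extends by Frobenius reciprocity along the second factor. The extensions still
    transform under $g$ like a basis of $M$, since $(g,1)$ and $(1,x)$ commute, so they assemble
    into a map on the outer tensor product. *)
Lemma surjects_onto_outer_induced (K : fieldType) (gT1 gT2 : finGroupType)
    (H : {group gT2}) (M : representation K [set: gT1]) (N : representation K H)
    n (W : mx_representation K [set: gT1 * gT2] n)
    (f : 'I_(rdegree M) -> 'M[K]_(rdegree N, n)) :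
  (forall h i, h \in H -> N h *m f i = f i *m W (1%g, h)) ->
  (forall g i, \sum_k M g i k *: f k = f i *m W (g, 1%g)) ->
  surjects_onto (outer_tensor M (induced N)) W
    (\sum_i \sum_x <<f i *m W (1%g, x)>>)%MS.
Proof.
move=> hN hM; pose rW x := W (1%g, x).
have rW_repr : mx_repr [set: gT2] rW.
  split=> [|x y _ _]; first exact: repr_mx1.
  by rewrite /rW -repr_mxM ?inE //; congr (W (_, _)); rewrite mul1g.
pose W2 := MxRepresentation rW_repr.
have hf i h : h \in H -> N h *m f i = f i *m W2 h by move=> hH; apply: hN.
pose F i := frobenius W2 (f i).
have hF g h i : induced N h *m (\sum_k M g i k *: F k) = F i *m W (g, h).
  have -> : (g, h) = ((1, h) * (g, 1))%g by apply: injective_projections;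
    rewrite /= ?mul1g ?mulg1.
  rewrite repr_mxM ?inE // mulmxA -[F i *m _](frobeniusJ (hf i) h) -[RHS]mulmxA.
  congr (_ *m _); apply: eq_mx_induced => j x.
  rewrite mulmxA (frobeniusE (hf i)) -mulmxA /= /rW -repr_mxM ?inE //.
  have -> : ((1, x) * (g, 1))%g = ((g, 1) * (1, x))%g :> gT1 * gT2.
    by apply: injective_projections; rewrite /= !(mul1g, mulg1).
  rewrite repr_mxM ?inE // mulmxA -[_ *m f i *m _]mulmxA -hM.
  rewrite mulmx_sumr mulmx_sumr mulmx_suml; apply: eq_bigr => k _.
  by rewrite -!scalemxAr (frobeniusE (hf k)) -scalemxAl.
have [B hB eB] := surjects_onto_outer hF; exists B => //.
apply: eqmx_trans eB _; apply: eqmx_sums => i _.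
by apply: eqmx_trans (genmxE _) (frobenius_eqmx (hf i)).
Qed.

(** The Frobenius map of the identity is onto already at $x=1$, and the index is 1, so it is also
    injective. *)
Lemma induced_full_rsim (K : fieldType) (gT : finGroupType)
    (M : representation K [set: gT]%G) : mx_rsim M (induced M).
Proof.
have h1 h : h \in [set: gT] -> M h *m 1%:M = 1%:M *m M h.
  by rewrite mulmx1 mul1mx.
pose F := frobenius M 1%:M.
have fullF : row_full F.
  rewrite -sub1mx (frobenius_eqmx h1) (sumsmx_sup 1%g) // genmxE mul1mx.
  by rewrite repr_mx1.
have dF : rdegree (induced M) = rdegree M.
  apply/eqP; rewrite eqn_leq -{2}(eqP fullF) rank_leq_row andbT.
  by have := rdegree_induced_le M; rewrite indexgg muln1.
apply: mx_rsim_sym; exists F => //; first by rewrite /row_free (eqP fullF) dF.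
by move=> x _; apply: frobeniusJ h1 x.
Qed.

(** * Tabloids and column symmetrizers *)

Section Tabloids.

Variables (nu : seq nat) (E : finType).
Implicit Types (u v : {ffun diagram nu -> E}) (q : {perm diagram nu}).

Lemma tabloidP u v :
  reflect (exists2 q : {perm diagram nu},
              forall d, box_row (q d) = box_row d & v = [ffun d => u (q d)])
          (v \in tabloid u).
Proof.
rewrite inE; apply: (iffP existsP) => -[q].
  by case/andP=> /forallP rq /eqP->; exists q => // d; apply/eqP.
by move=> rq ->; exists q; rewrite eqxx andbT; apply/forallP=> d; rewrite rq.
Qed.

Lemma tabloid_refl u : u \in tabloid u.
Proof.
apply/tabloidP; exists 1%g => [d|]; first by rewrite perm1.
by apply/ffunP=> d; rewrite ffunE perm1.
Qed.

Lemma tabloid_mem_eq u v : v \in tabloid u -> tabloid v = tabloid u.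
Proof.
case/tabloidP=> q rq ->; apply/setP=> w; apply/tabloidP/tabloidP => -[r rr ->].
  exists (r * q)%g => [d|]; first by rewrite permM rq.
  by apply/ffunP=> d; rewrite !ffunE permM.
exists (r * q^-1)%g => [d|].
  by rewrite permM -rq permKV rr.
by apply/ffunP=> d; rewrite !ffunE permM permKV.
Qed.

Lemma tabloid_eq u v : tabloid u = tabloid v <-> v \in tabloid u.
Proof. by split=> [->|/tabloid_mem_eq->]; first exact: tabloid_refl. Qed.

Lemma tabloid_act (gT : finGroupType) (to : {action gT &-> E}) u g :
  (fill_action nu to)^*%act (tabloid u) g = tabloid (fill_act to u g).
Proof.
apply/setP=> w; apply/imsetP/tabloidP => [[v /tabloidP[q rq ->] ->]|[q rq ->]].
  by exists q => //; apply/ffunP=> d; rewrite !ffunE.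
exists [ffun d => u (q d)]; first by apply/tabloidP; exists q.
by apply/ffunP=> d; rewrite !ffunE.
Qed.

End Tabloids.

(** Invariance of the standard bilinear form, whose restriction to a Specht module is the form of
    [specht_selfdual]. *)
Lemma permmod_mx_orthogonal (K : fieldType) (gT : finGroupType) (T : finType)
    (to : {action gT &-> T}) g :
  permmod_mx K to g *m (permmod_mx K to g)^T = 1%:M.
Proof.
apply/matrixP=> i k; rewrite !mxE (bigD1 (enum_rank (to (enum_val i) g))) //=.
rewrite !mxE !eqxx mul1r big1 ?addr0 => [|j ji].
  by rewrite (inj_eq enum_rank_inj) (inj_eq (act_inj to g)) (inj_eq enum_val_inj).
by rewrite !mxE (negPf ji) andbF mul0r.
Qed.

Section Positions.

Variables (b : nat) (nu : seq nat).
Implicit Type t : {ffun diagram nu -> 'I_b}.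

Lemma box_at_subproof t (ht : is_tableau t) l : {d | t d == l}.
Proof.
apply: sigW; have /forallP/(_ l)/cards1P[d e] := ht.
by exists d; have := set11 d; rewrite -e inE.
Qed.

Definition box_at t (ht : is_tableau t) l := sval (box_at_subproof ht l).

Lemma box_atK t (ht : is_tableau t) l : t (box_at ht l) = l.
Proof. exact/eqP/(svalP (box_at_subproof ht l)). Qed.

Lemma tableau_inj t : is_tableau t -> injective t.
Proof.
move=> ht d d' e; have /forallP/(_ (t d))/cards1P[d0 e0] := ht.
have : d \in [set d0] by rewrite -e0 inE.
have : d' \in [set d0] by rewrite -e0 inE e.
by rewrite !inE => /eqP-> /eqP->.
Qed.

Lemma tableauK t (ht : is_tableau t) d : box_at ht (t d) = d.
Proof. by apply: (tableau_inj ht); rewrite box_atK. Qed.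

Lemma tableau_bij t : bijective t -> is_tableau t.
Proof.
case=> s tK sK; apply/forallP=> l; apply/cards1P; exists (s l).
by apply/setP=> d; rewrite !inE; apply/eqP/eqP => [<-|->].
Qed.

Lemma mem_col_stab t (ht : is_tableau t) (p : 'S_b) :
  reflect (forall l, box_col (box_at ht (p l)) = box_col (box_at ht l))
          (p \in col_stab t).
Proof.
rewrite inE; apply: (iffP forallP) => [cp l|cp d].
  have /forallP/(_ (box_at ht (p l)))/implyP := cp (box_at ht l).
  by rewrite !box_atK => /(_ (eqxx _))/eqP.
by apply/forallP=> d'; apply/implyP=> /eqP e; have := cp (t d);
  rewrite -e !tableauK => ->.
Qed.

Lemma col_stabM t p q : is_tableau t ->
  p \in col_stab t -> ((p * q)%g \in col_stab t) = (q \in col_stab t).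
Proof.
move=> ht /(mem_col_stab ht) cp; apply/(mem_col_stab ht)/(mem_col_stab ht) => cq l.
  by rewrite -(permKV p l) -permM cq cp.
by rewrite permM cq cp.
Qed.

Lemma col_stab1 t : is_tableau t -> 1%g \in col_stab t.
Proof. by move=> ht; apply/(mem_col_stab ht) => l; rewrite perm1. Qed.

Lemma tabloid_tableau_eq t u (ht : is_tableau t) (hu : is_tableau u) :
  tabloid t = tabloid u <-> forall l, box_row (box_at ht l) = box_row (box_at hu l).
Proof.
rewrite tabloid_eq; split=> [/tabloidP[q rq eu] l|rE].
  rewrite -(rq (box_at hu l)); congr box_row; apply: (tableau_inj ht).
  by rewrite box_atK -[LHS](box_atK hu l); move/ffunP/(_ (box_at hu l)): eu;
    rewrite ffunE.
have inj_q : injective (fun d => box_at ht (u d)).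
  by move=> d d' /(congr1 t); rewrite !box_atK => /(tableau_inj hu).
apply/tabloidP; exists (perm inj_q) => [d|]; first by rewrite permE rE tableauK.
by apply/ffunP=> d; rewrite ffunE permE box_atK.
Qed.

Lemma perm_tableau t (g : 'S_b) :
  is_tableau t -> is_tableau (fill_act (perm_action 'I_b) t g).
Proof.
move=> ht; apply: tableau_bij; exists (fun l => box_at ht ((g^-1)%g l)) => [d|l].
  by rewrite ffunE /= apermE permK tableauK.
by rewrite ffunE /= apermE box_atK permKV.
Qed.

End Positions.

Section ColumnSymmetrizer.

Variables (K : fieldType) (b : nat) (la : seq nat) (t : {ffun diagram la -> 'I_b}).
Hypothesis ht : is_tableau t.

Definition col_symmetrizer n (rG : mx_representation K [set: 'S_b] n) : 'M[K]_n :=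
  \sum_(p in col_stab t) (-1) ^+ p *: rG p.

Lemma col_stab_symmetrizer n (rG : mx_representation K [set: 'S_b] n) p :
  p \in col_stab t -> rG p *m col_symmetrizer rG = (-1) ^+ p *: col_symmetrizer rG.
Proof.
move=> cp; rewrite mulmx_sumr scaler_sumr [RHS](reindex_inj (mulgI p)) /=.
apply: eq_big => [q|q _]; first by rewrite col_stabM.
by rewrite repr_mxM ?inE // odd_permM signr_addb -scalemxAr scalerA mulrA -signr_addb
  addbb mul1r.
Qed.

Lemma col_symmetrizer_sq n (rG : mx_representation K [set: 'S_b] n) :
  col_symmetrizer rG *m col_symmetrizer rG
    = #|col_stab t|%:R *: col_symmetrizer rG.
Proof.
rewrite {1}/col_symmetrizer mulmx_suml scaler_nat -sumr_const; apply: eq_bigr => p cp.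
by rewrite -scalemxAl col_stab_symmetrizer // scalerA -signr_addb addbb scale1r.
Qed.

End ColumnSymmetrizer.

(** * Dominance *)

Lemma leq_card_rel (S T : finType) (A : {set S}) (B : {set T}) (r : S -> T -> bool) :
  (forall x, x \in A -> exists2 y, y \in B & r x y) ->
  (forall x x' y, x \in A -> x' \in A -> r x y -> r x' y -> x = x') ->
  (#|A| <= #|B|)%N.
Proof.
move=> ex inj; pose f x := [pick y in B | r x y].
have fP x : x \in A -> exists2 y, f x = Some y & (y \in B) && r x y.
  move=> /ex[y yB rxy]; rewrite /f; case: pickP => [z zP|/(_ y)]; first by exists z.
  by rewrite yB rxy.
rewrite -(card_in_imset (f := f)) => [|x x' xA x'A].
  have injS : injective (@Some T) by move=> ? ? [].
  rewrite -(card_imset (mem B) injS); apply/subset_leq_card/subsetP.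
  by move=> _ /imsetP[x /fP[y -> /andP[yB _]] ->]; apply: imset_f.
have [y -> /andP[_ rx]] := fP x xA; have [y' -> /andP[_ rx']] := fP x' x'A.
by case=> e; apply: inj rx _; rewrite // e.
Qed.

Lemma card_fibers (T : finType) (A : {set T}) (f : T -> nat) N :
  (forall x, x \in A -> (f x < N)%N) ->
  #|A| = (\sum_(j < N) #|[set x in A | f x == j]|)%N.
Proof.
move=> ltfN; rewrite -sum1_card.
under [RHS]eq_bigr => j _ do rewrite -sum1_card.
case: N ltfN => [|N] ltfN.
  by rewrite big_ord0 big1 // => x /ltfN.
rewrite (partition_big (fun x => inord (f x) : 'I_N.+1) predT) //=.
apply: eq_bigr => j _; apply: eq_bigl => x; rewrite inE.
by case xA: (x \in A) => //=; rewrite -val_eqE /= inordK ?ltfN.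
Qed.

(** Its cardinality is the sum of the first [k] parts ([boxes_aboveS]), so comparing these for all
    [k] is the dominance order. *)
Definition boxes_above nu k : {set diagram nu} := [set d | (box_row d < k)%N].

Lemma box_exists nu i j : (j < nth 0 nu i)%N ->
  exists d : diagram nu, box_row d = i /\ box_col d = j.
Proof.
move=> ji; have iS : (i < size nu)%N by rewrite ltnNge;
  apply/negP=> /(nth_default 0) e; rewrite e in ji.
by exists (Tagged (fun i : 'I_(size nu) => 'I_(nth 0%N nu i)) (Ordinal ji : 'I_(nth
  0%N nu (Ordinal iS)))).
Qed.

Lemma box_colP nu (d : diagram nu) : (box_col d < nth 0 nu (box_row d))%N.
Proof. exact: ltn_ord. Qed.

Lemma box_inj nu (d d' : diagram nu) :
  box_row d = box_row d' -> box_col d = box_col d' -> d = d'.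
Proof.
case: d d' => [i j] [i' j']; rewrite /box_row /box_col /= => /val_inj ei.
by case: _ / ei j' => j' /val_inj->.
Qed.

Section Dominance.

Variables (b : nat) (la mu : seq nat).
Variables (t : {ffun diagram la -> 'I_b}) (u : {ffun diagram mu -> 'I_b}).
Hypotheses (ht : is_tableau t) (hu : is_tableau u).
Hypothesis la_sorted : sorted geq la.
Hypothesis sep : forall x y, box_row (box_at hu x) = box_row (box_at hu y) ->
  box_col (box_at ht x) = box_col (box_at ht y) -> x = y.

Let ru l := box_row (box_at hu l).
Let ct l := box_col (box_at ht l).
Let N := (\max_(d : diagram la) box_col d).+1.

Let entries k := [set l | (ru l < k)%N].

Let colN (d : diagram la) : (box_col d < N)%N.
Proof. by rewrite ltnS (leq_bigmax d). Qed.

(** If column [j] of [la] reaches at least [k] rows down, the letters counted lie in distinct rows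
    of [u] by [sep], so there are at most [k] of them. Otherwise the whole column lies in the first
    [k] rows and bounds the count through the positions in [t]. *)
Lemma col_count_le k j :
  (#|[set l in entries k | ct l == j]|
     <= #|[set d in boxes_above la k | box_col d == j]|)%N.
Proof.
have [/forallP full|] := boolP [forall i : 'I_k, j < nth 0 la i]%N.
  apply: (@leq_card_rel _ _ _ _ (fun l d => box_row d == ru l)).
    move=> l; rewrite !inE => /andP[lk _].
    have [d [rd cd]] := box_exists (full (Ordinal lk)).
    by exists d; rewrite ?inE rd ?cd ?eqxx ?lk.
  move=> x y d; rewrite !inE => /andP[_ /eqP cx] /andP[_ /eqP cy] /eqP rx /eqP ry.
  by apply: sep; [rewrite -[LHS]rx -[RHS]ry | rewrite -/(ct x) -/(ct y) cx cy].
(* Row [i] does not reach column [j]; since [la] decreases, no lower row does either. *)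
case/forallPn=> i; rewrite -leqNgt => laij.
apply: (@leq_card_rel _ _ _ _ (fun l d => d == box_at ht l)).
  move=> l; rewrite !inE => /andP[_ /eqP cl]; exists (box_at ht l) => //.
  rewrite !inE -/(ct l) cl eqxx andbT; apply: leq_ltn_trans (ltn_ord i).
  rewrite leqNgt; apply/negP=> lt_i.
  have iS : (box_row (box_at ht l) < size la)%N by apply: ltn_ord.
  have := box_colP (box_at ht l); rewrite -/(ct l) cl ltnNge => /negP; apply.
  apply: leq_trans laij.
  have geq_tr : transitive geq by move=> x y z xy yz; apply: leq_trans yz xy.
  apply: (sorted_leq_nth geq_tr leqnn 0 la_sorted); rewrite ?inE ?(ltnW lt_i) //.
  exact: ltn_trans lt_i iS.
move=> x y d _ _ /eqP-> /eqP/(congr1 t).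
by rewrite !box_atK.
Qed.

Let card_entries k : #|entries k| = #|boxes_above mu k|.
Proof.
have inj : injective (box_at hu) by move=> x y /(congr1 u); rewrite !box_atK.
rewrite -(card_imset _ inj); apply: eq_card => d; rewrite inE.
apply/imsetP/idP => [[l lk ->]|dk]; first by move: lk; rewrite inE.
by exists (u d); rewrite ?inE /ru tableauK.
Qed.

Let count_entries k : #|boxes_above mu k| = (\sum_(j < N) #|[set l in entries k | ct l
  == j]|)%N.
Proof. by rewrite -card_entries; apply: card_fibers => l _; apply: colN. Qed.

Let count_boxes k : #|boxes_above la k| =
  (\sum_(j < N) #|[set d in boxes_above la k | box_col d == j]|)%N.
Proof. by apply: card_fibers => l _; apply: colN. Qed.

Lemma dominance k : (#|boxes_above mu k| <= #|boxes_above la k|)%N.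
Proof. by rewrite count_entries count_boxes; apply: leq_sum => j _;
  apply: col_count_le. Qed.

(** Equal totals force equality in [col_count_le] for every column. Passing from [k = ru l] to its
    successor adds the letter [l] to the count in column [ct l], so a box must appear there in row
    [ru l]. *)
Lemma dominance_eq : (forall k, #|boxes_above mu k| = #|boxes_above la k|) ->
  forall l, exists d : diagram la, box_row d = ru l /\ box_col d = ct l.
Proof.
move=> eqk l.
have eqkj k : #|[set l' in entries k | ct l' == ct l]| =
    #|[set d in boxes_above la k | box_col d == ct l]|.
  have le (j : 'I_N) := leqif_eq (col_count_le k j).
  have [_] := leqif_sum (fun j (_ : true) => le j).
  rewrite -count_entries -count_boxes eqk eqxx => /esym/forallP/(_ (Ordinal (colN
    (box_at ht l)))).
  by move/eqP.
pose A k := [set l' in entries k | ct l' == ct l].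
pose B k := [set d in boxes_above la k | box_col d == ct l].
have ltA : (#|A (ru l)| < #|A (ru l).+1|)%N.
  apply/proper_card/properP; split.
    by apply/subsetP=> x; rewrite !inE => /andP[/ltnW xk ->]; rewrite ltnS xk.
  by exists l; rewrite !inE eqxx ?ltnS ?leqnn ?ltnn.
move: ltA; rewrite /A !eqkj -/(B _) -/(B _) => ltB.
have /subsetPn[d] : ~~ (B (ru l).+1 \subset B (ru l)).
  by apply: contraL ltB => /subset_leq_card; rewrite -leqNgt.
rewrite !inE => /andP[dk /eqP cd]; rewrite cd eqxx andbT -leqNgt => kd.
by exists d; split=> //; apply/eqP; rewrite eqn_leq kd -ltnS dk.
Qed.

End Dominance.

(* The column of l in t and its row in u determine a box, so t can be permuted *)
(* within its columns to have the same rows as u.                             *)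
Lemma separated_tabloid b la (t u : {ffun diagram la -> 'I_b})
    (ht : is_tableau t) (hu : is_tableau u) : sorted geq la ->
  (forall x y, box_row (box_at hu x) = box_row (box_at hu y) ->
     box_col (box_at ht x) = box_col (box_at ht y) -> x = y) ->
  exists2 p, p \in col_stab t & tabloid u = tabloid (fill_act (perm_action 'I_b) t p).
Proof.
move=> sla sep.
have /fin_all_exists[w wP] := dominance_eq sla sep (fun k => erefl).
have inj_w : injective w.
  move=> x y e; apply: sep.
    by have [<- _] := wP x; have [<- _] := wP y; rewrite e.
  by have [_ <-] := wP x; have [_ <-] := wP y; rewrite e.
have inj_p : injective (fun l => t (w l)) by move=> x y /(tableau_inj ht)/inj_w.
pose p := perm inj_p.
have cp : (p^-1)%g \in col_stab t.
  apply/(mem_col_stab ht) => l; rewrite -{2}(permKV p l) [in RHS]permE tableauK.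
  by have [_ ->] := wP ((p^-1)%g l).
exists p^-1%g => //; apply/(tabloid_tableau_eq hu (perm_tableau _ ht)) => l.
have [<- _] := wP l; congr box_row; apply: (tableau_inj (perm_tableau p^-1%g ht)).
by rewrite box_atK ffunE /= apermE -[t (w l)](permE inj_p) permK.
Qed.

(** * Specht modules *)

Lemma basis_tabloid_act (K : fieldType) (nu : seq nat) (gT : finGroupType)
    (E : finType) (to : {action gT &-> E}) (u : {ffun diagram nu -> E}) g :
  basis_vec K (tabloid u) *m tabloid_module nu to K g
    = basis_vec K (tabloid (fill_act to u g)).
Proof. by rewrite /= basis_vec_act tabloid_act. Qed.

Lemma basis_vec_dot (K : fieldType) (T : finType) (x y : T) :
  basis_vec K x *m (basis_vec K y)^T = (x == y)%:R%:M.
Proof.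
rewrite trmx_delta -colE; apply/matrixP=> i j.
by rewrite !ord1 !mxE eqxx (inj_eq enum_rank_inj) eq_sym mulr1n.
Qed.

Lemma box_at_act b nu (t : {ffun diagram nu -> 'I_b}) (g : 'S_b)
    (ht : is_tableau t) (ht' : is_tableau (fill_act (perm_action 'I_b) t g)) l :
  box_at ht' (g l) = box_at ht l.
Proof. by apply: (tableau_inj ht'); rewrite box_atK ffunE /= box_atK. Qed.

Lemma col_stab_tabloid_inj b nu (t : {ffun diagram nu -> 'I_b}) (p q : 'S_b) :
  is_tableau t -> p \in col_stab t -> q \in col_stab t ->
  tabloid (fill_act (perm_action 'I_b) t p) = tabloid (fill_act (perm_action 'I_b) t
    q) ->
  p = q.
Proof.
move=> ht /(mem_col_stab ht) cp /(mem_col_stab ht) cq.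
have hp := perm_tableau p ht; have hq := perm_tableau q ht.
move/(tabloid_tableau_eq hp hq) => rE; apply/permP=> l.
rewrite -[p l](permKV q); congr (q _); set l' := (q^-1)%g _; rewrite -/l'.
have pl : q l' = p l by rewrite permKV.
rewrite -(box_atK ht l') -[RHS](box_atK ht l); congr (t _); apply: box_inj.
  by rewrite -(box_at_act ht hq l') pl -rE (box_at_act ht).
by rewrite -cq pl cp.
Qed.

Lemma col_symmetrizer_hom (K : fieldType) b la (t : {ffun diagram la -> 'I_b})
    n1 (rG1 : mx_representation K [set: 'S_b] n1)
    n2 (rG2 : mx_representation K [set: 'S_b] n2) B :
  (forall g, rG1 g *m B = B *m rG2 g) ->
  col_symmetrizer t rG1 *m B = B *m col_symmetrizer t rG2.
Proof.
move=> hB; rewrite mulmx_suml mulmx_sumr; apply: eq_bigr => p _.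
by rewrite -scalemxAl hB scalemxAr.
Qed.

Section Polytabloids.

Variables (K : fieldType) (b : nat).
Hypothesis char0 : [pchar K] =i pred0.
Local Notation M nu := (tabloid_module nu (perm_action 'I_b) K).
Local Notation ptab t := (polytabloid (perm_action 'I_b) K t [ffun l => l]).
Local Notation kappa t nu := (col_symmetrizer t (M nu)).
Local Notation bv u := (basis_vec K (tabloid u)).

Lemma natr_neq0 n : (0 < n)%N -> n%:R != 0 :> K.
Proof. by rewrite (proj1 (pcharf0P _) char0) -lt0n. Qed.

Lemma polytabloidE la (t : {ffun diagram la -> 'I_b}) :
  ptab t = bv t *m kappa t la.
Proof.
rewrite mulmx_sumr; apply: eq_bigr => p _; rewrite -scalemxAr basis_tabloid_act.
by congr (_ *: bv _); apply/ffunP=> d; rewrite !ffunE.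
Qed.

(** If distinct $x,y$ shared a row of $u$ and a column of $t$, the transposition $(x\,y)$ would fix
    $\{u\}$ and be absorbed by $\kappa_t$ with sign $-1$, so $\{u\}\kappa_t$ would equal its own
    negative. *)
Lemma col_symmetrizer_separates la mu (t : {ffun diagram la -> 'I_b})
    (u : {ffun diagram mu -> 'I_b}) (ht : is_tableau t) (hu : is_tableau u) :
  bv u *m kappa t mu != 0 ->
  forall x y, box_row (box_at hu x) = box_row (box_at hu y) ->
    box_col (box_at ht x) = box_col (box_at ht y) -> x = y.
Proof.
move=> nz x y rxy cxy; apply: contraNeq nz => xy.
have ct : tperm x y \in col_stab t.
  by apply/(mem_col_stab ht) => l; case: tpermP => // ->.
have fu : tabloid (fill_act (perm_action 'I_b) u (tperm x y)) = tabloid u.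
  apply/esym/(tabloid_tableau_eq hu (perm_tableau _ hu)) => l.
  have -> : box_at (perm_tableau (tperm x y) hu) l = box_at hu (tperm x y l).
    apply: (tableau_inj (perm_tableau (tperm x y) hu)).
    by rewrite box_atK ffunE /= box_atK apermE tpermK.
  by case: tpermP => // ->.
set v := _ *m _; have : v = - v.
  rewrite {1}/v -fu -basis_tabloid_act -mulmxA (col_stab_symmetrizer ht _ ct).
  by rewrite odd_tperm xy expr1 scaleN1r mulmxN.
move/eqP; rewrite -addr_eq0 -mulr2n -scaler_nat scaler_eq0.
by rewrite (negPf (natr_neq0 _)).
Qed.

Section Shape.

Variable la : seq nat.
Hypothesis la_sorted : sorted geq la.

(** James' key fact: $\{u\}\kappa_t$ is $0$ or $\pm e_t$, because a separated $u$ has the tabloid of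
    a column permutation of $t$. *)
Lemma basis_symmetrizer_sub (t u : {ffun diagram la -> 'I_b}) :
  is_tableau t -> is_tableau u -> (bv u *m kappa t la <= ptab t)%MS.
Proof.
move=> ht hu; have [->|nz] := eqVneq (bv u *m kappa t la) 0; first exact: sub0mx.
have [p cp ->] := separated_tabloid la_sorted
  (col_symmetrizer_separates (ht := ht) (hu := hu) nz).
rewrite -basis_tabloid_act -mulmxA (col_stab_symmetrizer ht _ cp) -scalemxAr.
by rewrite scalemx_sub // polytabloidE.
Qed.

(** Distinct column permutations of $t$ give distinct tabloids, so the cross terms vanish. In
    particular $e_t\ne0$ in characteristic 0. *)
Lemma polytabloid_dot (t : {ffun diagram la -> 'I_b}) : is_tableau t ->
  ptab t *m (ptab t)^T = #|col_stab t|%:R%:M.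
Proof.
move=> ht; have -> : #|col_stab t|%:R%:M = \sum_(p in col_stab t) 1%:M :> 'M[K]_1.
  by rewrite sumr_const -scaler_nat scale_scalar_mx mulr1.
rewrite mulmx_suml; apply: eq_bigr => p cp.
rewrite [(\sum_(q in _) _)^T]linear_sum mulmx_sumr (bigD1 p) //= big1 ?addr0 => [|q
  /andP[cq qp]].
  by rewrite linearZ /= -scalemxAl -scalemxAr scalerA -signr_addb addbb scale1r
    basis_vec_dot eqxx.
rewrite linearZ /= -scalemxAl -scalemxAr basis_vec_dot.
case: eqP => [e|_]; last by rewrite /= mulr0n raddf0 !scaler0.
case/eqP: qp; apply: (col_stab_tabloid_inj ht cq cp); apply/esym.
have fE r : fill_act (perm_action 'I_b) t r = [ffun d => [ffun l => l] (r (t d))].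
  by apply/ffunP=> d; rewrite !ffunE.
by rewrite !fE.
Qed.

Lemma card_col_stab_neq0 (t : {ffun diagram la -> 'I_b}) : is_tableau t ->
  #|col_stab t|%:R != 0 :> K.
Proof. by move=> ht; rewrite natr_neq0 //; apply/card_gt0P; exists 1%g;
  apply: col_stab1. Qed.

Lemma polytabloid_neq0 (t : {ffun diagram la -> 'I_b}) : is_tableau t -> ptab t != 0.
Proof.
move=> ht; apply: contraTneq (card_col_stab_neq0 ht) => e0.
have := polytabloid_dot ht; rewrite e0 mul0mx => /esym/matrixP/(_ 0 0).
by rewrite !mxE mulr1n => ->; rewrite eqxx.
Qed.

Lemma polytabloid_symmetrizer (t : {ffun diagram la -> 'I_b}) : is_tableau t ->
  ptab t *m kappa t la = #|col_stab t|%:R *: ptab t.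
Proof. by move=> ht; rewrite polytabloidE -mulmxA col_symmetrizer_sq // -scalemxAr. Qed.

Definition specht_mx := gen_mx (M la) (@is_tableau b la) (fun t => ptab t).

Lemma specht_module : mxmodule (M la) specht_mx.
Proof. exact: gen_mx_module. Qed.

Lemma polytabloid_in_specht t : is_tableau t -> (ptab t <= specht_mx)%MS.
Proof. by move=> ht; rewrite (sumsmx_sup t) // cyclic_mx_id. Qed.

Lemma col_symmetrizer_mx_sub mu (t : {ffun diagram mu -> 'I_b}) n
   (rG : mx_representation K [set: 'S_b] n) (U : 'M_n) :
  mxmodule rG U -> (U *m col_symmetrizer t rG <= U)%MS.
Proof.
move=> modU; rewrite mulmx_sumr; apply: summx_sub => p _.
by rewrite -scalemxAr scalemx_sub // (mxmoduleP modU) ?inE.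
Qed.

(** The ambient module is free on all sets of fillings; this confines the Specht module to genuine
    tabloids, where [basis_symmetrizer_sub] and the dominance argument apply. *)
Lemma specht_sub_tabloids :
  (specht_mx <= \sum_(u | is_tableau u) <<bv u>>)%MS.
Proof.
apply/sumsmx_subP=> t ht; apply: cyclic_mx_sub.
  apply/mxmoduleP=> g _; rewrite sumsmxMr; apply/sumsmx_subP=> u hu.
  rewrite (eqmxMr _ (genmxE _)) basis_tabloid_act.
  by rewrite (sumsmx_sup _ (perm_tableau g hu)) ?genmxE.
rewrite summx_sub // => p _; rewrite scalemx_sub //.
have -> : [ffun d => [ffun l => l] (p (t d))] = fill_act (perm_action 'I_b) t p.
  by apply/ffunP=> d; rewrite !ffunE.
by rewrite (sumsmx_sup _ (perm_tableau p ht)) ?genmxE.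
Qed.

Lemma specht_symmetrizer_sub (t : {ffun diagram la -> 'I_b}) : is_tableau t ->
  (specht_mx *m kappa t la <= ptab t)%MS.
Proof.
move=> ht; apply: submx_trans (submxMr _ specht_sub_tabloids) _.
rewrite sumsmxMr; apply/sumsmx_subP=> u hu.
by rewrite (eqmxMr _ (genmxE _)) basis_symmetrizer_sub.
Qed.

Lemma polytabloid_act (t : {ffun diagram la -> 'I_b}) g : is_tableau t ->
  ptab t *m M la g = ptab (fill_act (perm_action 'I_b) t g).
Proof.
move=> ht; rewrite mulmx_suml [RHS](reindex_inj (conjg_inj g)) /=.
have ht' := perm_tableau g ht.
apply: eq_big => [p|p _].
  apply/(mem_col_stab ht)/(mem_col_stab ht') => cp l.
    by rewrite -(permKV g l) permJ !(box_at_act ht).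
  by rewrite -!(box_at_act ht ht') -permJ cp.
rewrite -scalemxAl basis_tabloid_act odd_permJ.
by congr (_ *: bv _); apply/ffunP=> d; rewrite !ffunE /= apermE permJ.
Qed.

Lemma specht_sub_cyclic (t : {ffun diagram la -> 'I_b}) m (U : 'M_(m, _)) :
  is_tableau t -> mxmodule (M la) U -> (ptab t <= U)%MS -> (specht_mx <= U)%MS.
Proof.
move=> ht modU tU; apply/sumsmx_subP=> u hu; apply: cyclic_mx_sub => //.
have inj_g : injective (fun l => u (box_at ht l)).
  by move=> x y /(tableau_inj hu)/(congr1 t); rewrite !box_atK.
have -> : ptab u = ptab (fill_act (perm_action 'I_b) t (perm inj_g)).
  congr polytabloid; apply/ffunP=> d.
  by rewrite ffunE /= apermE permE tableauK.
by rewrite -polytabloid_act //; apply: submx_trans (submxMr _ tU) (mxmoduleP modU _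
  (in_setT _)).
Qed.

(** Given a nonzero submodule $U$ with Maschke complement $W$, either $U\kappa_t\ne0$, so $U$
    contains the line of $e_t$ and is everything, or $\kappa_t$ kills $U$. In the latter case
    $|C_t|e_t=e_t\kappa_t$ lies in $W$, so $W$ is everything and $U=0$. *)
Lemma specht_irreducible (t : {ffun diagram la -> 'I_b}) : is_tableau t ->
  mx_irreducible (specht K b la).
Proof.
move=> ht; apply/submod_mx_irr; split=> [||U modU sUS nzU].
- exact: specht_module.
- apply: contraNneq (polytabloid_neq0 ht) => S0.
  by rewrite -submx0 -S0 polytabloid_in_specht.
have char' : [pchar K]^'.-group [set: 'S_b].
  by rewrite /pgroup pcharf'_nat natr_neq0 ?cardG_gt0.
have [W modW defS dxUW] := mx_reducibleS specht_module (submx1 _)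
  (mx_Maschke_pchar (M la) char') modU sUS.
have [Uk0|Uk] := eqVneq (U *m kappa t la) 0; last first.
  apply: (specht_sub_cyclic ht) => //.
  apply: submx_trans (col_symmetrizer_mx_sub t modU).
  have sUt := submx_trans (submxMr (kappa t la) sUS) (specht_symmetrizer_sub ht).
  rewrite -(mxrank_leqif_sup sUt) eqn_leq mxrankS //=.
  by apply: leq_trans (rank_leq_row _) _; rewrite lt0n mxrank_eq0.
have tW : (ptab t <= W)%MS.
  have /sub_addsmxP[[x y] /= exy] : (ptab t <= U + W)%MS.
    by rewrite defS polytabloid_in_specht.
  have := polytabloid_symmetrizer ht; rewrite {1}exy mulmxDl -!mulmxA Uk0 mulmx0 add0r.
  move/esym/(canRL (scalerK (card_col_stab_neq0 ht))) => ->; rewrite scalemx_sub //.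
  by apply: submx_trans (submxMl _ _) (col_symmetrizer_mx_sub t modW).
have sSW := specht_sub_cyclic ht modW tW.
have := mxdirect_addsP dxUW => /eqP; rewrite -submx0 => UW0.
case/negP: nzU; rewrite -submx0; apply: submx_trans UW0.
by rewrite sub_capmx submx_refl (submx_trans sUS).
Qed.

Lemma val_specht (g : 'S_b) :
  specht K b la g *m val_submod (1%:M : 'M_(\rank specht_mx))
    = val_submod (1%:M : 'M_(\rank specht_mx)) *m M la g.
Proof.
have := val_submodJ specht_module (1%:M : 'M_(\rank specht_mx)) (in_setT g).
by rewrite mul1mx val_submodE.
Qed.

(** [Ga] is the Gram matrix of the standard form on the Specht module. Its kernel is a submodule,
    and it is not everything because $\langle e_t,e_t\rangle=|C_t|\ne0$; irreducibility makes it
    zero. *)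
Lemma specht_selfdual (t : {ffun diagram la -> 'I_b}) : is_tableau t ->
  exists2 Ga : 'M_(rdegree (specht K b la)), Ga \in unitmx &
    forall g, specht K b la g *m Ga *m (specht K b la g)^T = Ga.
Proof.
move=> ht; pose V := val_submod (1%:M : 'M_(\rank specht_mx)); pose Ga := V *m V^T.
have GaJ g : specht K b la g *m Ga *m (specht K b la g)^T = Ga.
  rewrite mulmxA val_specht -[_ *m _ *m _]mulmxA -trmx_mul val_specht trmx_mul mulmxA.
  by rewrite -[_ *m M la g *m _]mulmxA permmod_mx_orthogonal mulmx1.
exists Ga => //; rewrite -row_free_unit -kermx_eq0.
apply: contraT => nzker.
have modker : mxmodule (specht K b la) (kermx Ga).
  apply/mxmoduleP=> g _; apply/sub_kermxP.
  have ker_mul (Q r : 'M_(\rank specht_mx)) : r^T \in unitmx ->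
      r *m Q *m r^T = Q -> kermx Q *m r *m Q = 0.
    move=> ur rE; apply: (can_inj (mulmxK ur)).
    by rewrite mul0mx -(mulmxA (kermx Q)) -(mulmxA (kermx Q)) rE mulmx_ker.
  by apply: ker_mul (GaJ g); rewrite unitmx_tr repr_mx_unit ?inE.
have [_ _ /(_ _ modker (submx1 _) nzker)] := specht_irreducible ht.
move/sub_kermxP; rewrite mul1mx => Ga0.
have e0 := polytabloid_dot ht; have tS := polytabloid_in_specht ht.
rewrite -(in_submodK tS) val_submodE trmx_mul mulmxA -(mulmxA _ V) -/Ga Ga0 in e0.
move/matrixP/(_ 0 0): e0; rewrite mulmx0 mul0mx !mxE mulr1n => /eqP.
by rewrite eq_sym (negPf (card_col_stab_neq0 ht)).
Qed.

End Shape.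

(** $\kappa_t$ does not kill $e_t$, so it acts nontrivially on the isomorphic $S^\mu$. Hence
    $\{u\}\kappa_t\ne0$ for some $\mu$-tableau $u$, and separation gives dominance. *)
Lemma specht_rsim_dominates la mu (t : {ffun diagram la -> 'I_b}) k :
  is_tableau t -> sorted geq la -> mx_rsim (specht K b la) (specht K b mu) ->
  (#|boxes_above mu k| <= #|boxes_above la k|)%N.
Proof.
move=> ht la_sorted [B eN freeB hB].
have [/existsP[u /andP[hu nz]]|no_u] :=
    boolP [exists u, is_tableau u && (bv u *m kappa t mu != 0)].
  exact: (dominance la_sorted (col_symmetrizer_separates (ht := ht) (hu := hu) nz)).
have k0 : col_symmetrizer t (specht K b mu) = 0.
  apply: (row_free_inj (row_base_free (specht_mx mu))).
  have V1 : val_submod (1%:M : 'M_(\rank (specht_mx mu))) = row_base (specht_mx mu).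
    by rewrite /val_submod /= mul1mx.
  rewrite mul0mx -V1 (col_symmetrizer_hom t (@val_specht mu)).
  apply/eqP; rewrite -submx0; apply: submx_trans (submxMr _ _) _.
    exact: submx_trans (val_submodP _) (specht_sub_tabloids mu).
  rewrite sumsmxMr; apply/sumsmx_subP=> u hu; rewrite (eqmxMr _ (genmxE _)).
  by move/existsPn/(_ u): no_u; rewrite hu negbK => /eqP->; apply: sub0mx.
have kB : col_symmetrizer t (specht K b la) = 0.
  apply: (row_free_inj freeB); rewrite mul0mx.
  by rewrite (col_symmetrizer_hom t (fun g => hB g (in_setT g))) k0 mulmx0.
have := polytabloid_symmetrizer ht; have tS := polytabloid_in_specht ht.
rewrite -{1}(in_submodK tS) val_submodE -mulmxA -(col_symmetrizer_hom t (@val_specht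
  la)).
rewrite kB mul0mx mulmx0 => /esym/eqP; rewrite scaler_eq0.
by rewrite (negPf (card_col_stab_neq0 ht)) (negPf (polytabloid_neq0 ht)).
Qed.

End Polytabloids.

Lemma boxes_aboveS nu k :
  #|boxes_above nu k.+1| = (#|boxes_above nu k| + nth 0%N nu k)%N.
Proof.
rewrite -(cardsID (boxes_above nu k)) setIC (setIidPl _); last first.
  by apply/subsetP=> d; rewrite !inE => /ltnW.
congr (_ + _)%N; have [kS|kS] := ltnP k (size nu); last first.
  rewrite nth_default //; apply: eq_card0 => d; rewrite !inE -leqNgt.
  by rewrite leqNgt (leq_trans _ kS) // ltn_ord.
pose f (j : 'I_(nth 0%N nu (Ordinal kS))) : diagram nu :=
  Tagged (fun i : 'I_(size nu) => 'I_(nth 0%N nu i)) j.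
have inj_f : injective f by move=> j j' e; apply/val_inj;
  have := congr1 (@box_col nu) e.
rewrite -[RHS](card_ord (nth 0%N nu (Ordinal kS))) -(card_imset _ inj_f).
apply: eq_card => d; rewrite !inE -leqNgt ltnS -eqn_leq.
apply/eqP/imsetP => [dk|[j _ ->] //].
have jd : (box_col d < nth 0%N nu k)%N by rewrite dk box_colP.
by exists (Ordinal jd : 'I_(nth 0%N nu (Ordinal kS))) => //; apply: box_inj.
Qed.

Lemma eq_boxes_above la mu : 0%N \notin la -> 0%N \notin mu ->
  (forall k, #|boxes_above la k| = #|boxes_above mu k|) -> la = mu.
Proof.
move=> la0 mu0 e; have en k : nth 0%N la k = nth 0%N mu k.
  by apply/eqP; have /eqP := e k.+1; rewrite !boxes_aboveS e eqn_add2l.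
have le (s1 s2 : seq nat) : 0%N \notin s2 -> (forall k, nth 0%N s1 k = nth 0%N s2 k) ->
    (size s2 <= size s1)%N.
  move=> s20 es; rewrite leqNgt; apply: contra s20 => lt12.
  by rewrite -(nth_default 0%N (leqnn (size s1))) es mem_nth.
by apply: (@eq_from_nth _ 0%N) => [|k _]; rewrite ?en //; apply/eqP;
  rewrite eqn_leq !le.
Qed.

Lemma card_diagram nu : #|diagram nu| = sumn nu.
Proof.
rewrite card_tagged; congr sumn; apply: (@eq_from_nth _ 0%N) => [|i].
  by rewrite size_map size_enum_ord.
rewrite size_map size_enum_ord => iS; rewrite (nth_map (Ordinal iS)) ?size_enum_ord //.
by rewrite card_ord nth_enum_ord.
Qed.

Lemma tableau_exists b nu : is_partition b nu ->
  exists t : {ffun diagram nu -> 'I_b}, is_tableau t.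
Proof.
case/and3P=> _ _ /eqP sum_nu; have cD : #|diagram nu| = b by rewrite card_diagram.
exists [ffun d => cast_ord cD (enum_rank d)]; apply: tableau_bij.
exists (fun l => enum_val (cast_ord (esym cD) l)) => [d|l].
  by rewrite ffunE cast_ordK enum_rankK.
by rewrite ffunE enum_valK cast_ordKV.
Qed.

(** * Specht modules as a complete family of irreducibles *)

Section SpechtFamily.

Variables (K : closedFieldType) (b : nat).
Hypothesis char0 : [pchar K] =i pred0.
Local Notation S := (fun la : intpart b => specht K b (parts la)).

Lemma parts_partition (la : intpart b) : is_partition b (parts la).
Proof. by apply/intpartP; exists la. Qed.

Lemma parts_inj : injective (@parts b).
Proof. by move=> la mu /(inj_map val_inj)/val_inj/val_inj. Qed.

Lemma specht_parts_irreducible la : mx_irreducible (S la).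
Proof.
have [t ht] := tableau_exists (parts_partition la).
by have [sla _ _] := and3P (parts_partition la); apply: specht_irreducible ht.
Qed.

Lemma specht_parts_rsim la mu : mx_rsim (S la) (S mu) -> la = mu.
Proof.
move=> sim; apply: parts_inj.
have [sla la0 _] := and3P (parts_partition la);
  have [t ht] := tableau_exists (parts_partition la).
have [smu mu0 _] := and3P (parts_partition mu);
  have [u hu] := tableau_exists (parts_partition mu).
apply: eq_boxes_above => // k; apply/eqP; rewrite eqn_leq.
rewrite (specht_rsim_dominates char0 k ht sla sim).
by rewrite (specht_rsim_dominates char0 k hu smu (mx_rsim_sym sim)).
Qed.

Lemma specht_sum_degree : (\sum_la rdegree (S la) ^ 2 <= b`!)%N.
Proof.
rewrite -card_Sn; have := sum_degree_le char0 specht_parts_irreducible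
  specht_parts_rsim.
by rewrite cardsT.
Qed.

Lemma specht_faithful (c : 'S_b -> K) :
  (forall la, \sum_x c x *: S la x = 0) -> forall x, c x = 0.
Proof.
move=> c0 x; apply: (irr_family_faithful char0 specht_parts_irreducible
  specht_parts_rsim
  (card_classes_Sym b)); last exact: in_setT.
by move=> la; rewrite -[RHS](c0 la); apply: eq_bigl => y; rewrite inE.
Qed.

Lemma specht_parts_selfdual la : exists2 Ga : 'M_(rdegree (S la)), Ga \in unitmx &
  forall g, S la g *m Ga *m (S la g)^T = Ga.
Proof.
have [t ht] := tableau_exists (parts_partition la).
by have [sla _ _] := and3P (parts_partition la); apply: specht_selfdual ht.
Qed.

End SpechtFamily.

(** * Transversal set partitions *)

Lemma surjects_onto_module (K : fieldType) (gT : finGroupType) (G : {group gT})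
    n1 (V : mx_representation K G n1) n2 (W : mx_representation K G n2) S :
  surjects_onto V W S -> mxmodule W S.
Proof.
case=> B hB eB; rewrite -(eqmx_module W eB); apply/mxmoduleP=> g Gg.
by rewrite -hB // submxMl.
Qed.

Lemma leq_rank_basis_vec (K : fieldType) (T : finType) (O : {set T}) m (S : 'M[K]_(m,
  #|T|)) :
  (forall x, x \in O -> (basis_vec K x <= S)%MS) -> (#|O| <= \rank S)%N.
Proof.
move=> OS; pose E : 'M[K]_(#|O|, #|T|) := \matrix_(i < #|O|) basis_vec K (enum_val i).
have fE : row_free E.
  apply/row_freeP; exists E^T; apply/matrixP=> i j.
  rewrite !mxE; have := basis_vec_dot K (enum_val i) (enum_val j).
  move/matrixP/(_ 0 0); rewrite !mxE mulr1n (inj_eq enum_val_inj) => <-.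
  by apply: eq_bigr => k _; rewrite !mxE.
rewrite -(eqP fE); apply: mxrankS; apply/row_subP=> i; rewrite rowK.
exact/OS/enum_valP.
Qed.

Lemma imset_permM (T : finType) (x y : {perm T}) (A : {set T}) :
  (x * y)%g @: A = y @: (x @: A).
Proof. by rewrite -imset_comp; apply: eq_imset => k; rewrite /= permM. Qed.

Lemma imset_perm1 (T : finType) (A : {set T}) : (1%g : {perm T}) @: A = A.
Proof. by rewrite -[RHS]imset_id; apply: eq_imset => k; rewrite perm1. Qed.

Lemma col_mul_rowE (K : fieldType) d n (A : 'M[K]_d) (w : 'rV_n) i j k :
  ((row i A)^T *m w) j k = A i j * w 0 k.
Proof. by rewrite mxE big_ord1 !mxE. Qed.

Lemma mul_tr_row (K : fieldType) d (A B C : 'M[K]_d) i :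
  B *m C *m B^T = C -> B *m (row i (A *m B *m C))^T = (row i (A *m C))^T.
Proof.
move=> eC; apply: trmx_inj; rewrite trmx_mul !trmxK -{2}eC -row_mul.
by rewrite !mulmxA.
Qed.

Lemma tr_row_mul (K : fieldType) d (A B : 'M[K]_d) i :
  (row i (A *m B))^T = \sum_k A i k *: (row k B)^T.
Proof.
rewrite row_mul mulmx_sum_row linear_sum; apply: eq_bigr => k _.
by rewrite linearZ mxE.
Qed.

Section SetPartitions.

Variables (b a m : nat).
Implicit Types Y Z : 'I_b -> {set 'I_m}.

Definition is_set_partition Y :=
  [/\ forall j, #|Y j| = a, forall j k l, l \in Y j -> l \in Y k -> j = k
    & forall l, exists j, l \in Y j].

(** Corresponding blocks have the same size, so their enumerations can be matched entry by entry. *)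
Lemma set_partition_transitive Y Z : is_set_partition Y -> is_set_partition Z ->
  exists x : 'S_m, forall j, x @: Y j = Z j.
Proof.
move=> [cY dY covY] [cZ dZ covZ]; have /fin_all_exists[idx idxP] := covY.
pose f k := nth k (enum (Z (idx k))) (index k (enum (Y (idx k)))).
have ltI k : (index k (enum (Y (idx k))) < size (enum (Z (idx k))))%N.
  by rewrite -cardE cZ -(cY (idx k)) cardE index_mem mem_enum.
have fZ k : f k \in Z (idx k) by rewrite -mem_enum mem_nth.
have inj_f : injective f.
  move=> k k' e; have ei : idx k = idx k' by apply: dZ (fZ k) _; rewrite e fZ.
  move/eqP: e; rewrite /f (set_nth_default k) // -ei nth_uniq ?enum_uniq //.
    by move/eqP/(congr1 (nth k (enum (Y (idx k))))); rewrite !nth_index ?mem_enum // ei.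
  by rewrite ei ltI.
exists (perm inj_f) => j; apply/eqP; rewrite eqEcard; apply/andP; split.
  apply/subsetP=> _ /imsetP[k kj ->]; rewrite permE.
  by rewrite (dY j (idx k) k).
by rewrite card_imset ?cY ?cZ //; apply: perm_inj.
Qed.

End SetPartitions.

(** * One-row tabloids as unordered families *)

Section OneRow.

Variables (b : nat) (t : {ffun diagram [:: b] -> 'I_b}).
Hypothesis ht : is_tableau t.

Lemma one_row_box_row (d : diagram [:: b]) : box_row d = 0%N.
Proof. by case: d => i j; rewrite /box_row /= (ord1 i). Qed.

Lemma one_row_col_stab : col_stab t = [set 1%g].
Proof.
apply/setP=> p; rewrite in_set1; apply/(mem_col_stab ht)/eqP => [cp|-> l];
  last by rewrite perm1.
apply/permP=> l; rewrite perm1 -[LHS](box_atK ht) -[RHS](box_atK ht); congr (t _).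
by apply: box_inj (cp l); rewrite !one_row_box_row.
Qed.

Variable E : finType.

Definition row_tabloid (X : 'I_b -> E) := tabloid [ffun d => X (t d)].

Lemma row_tabloid_eq X X' :
  row_tabloid X = row_tabloid X' <-> exists p : 'S_b, forall l, X' l = X (p l).
Proof.
split=> [/tabloid_eq/tabloidP[q _ /ffunP e]|[p e]].
  have inj_p : injective (fun l => t (q (box_at ht l))).
    by move=> x y /(tableau_inj ht)/perm_inj/(congr1 t); rewrite !box_atK.
  exists (perm inj_p) => l; rewrite permE.
  by have := e (box_at ht l); rewrite !ffunE box_atK.
have inj_q : injective (fun d => box_at ht (p (t d))).
  by move=> x y /(congr1 t); rewrite !box_atK => /perm_inj/(tableau_inj ht).
apply/tabloid_eq/tabloidP; exists (perm inj_q) => [d|];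
  first by rewrite !one_row_box_row.
by apply/ffunP=> d; rewrite !ffunE permE box_atK.
Qed.

Lemma row_polytabloid (K : fieldType) (gT : finGroupType) (to : {action gT &-> E})
    (X : {ffun 'I_b -> E}) :
  polytabloid to K t X = basis_vec K (row_tabloid X).
Proof.
rewrite /polytabloid one_row_col_stab big_set1 odd_perm1 expr0 scale1r.
by congr basis_vec; congr tabloid; apply/ffunP=> d; rewrite !ffunE perm1.
Qed.

End OneRow.

(** * The summand for an abstract block stabilizer *)

Section Transversal.

Variables (K : closedFieldType) (b m a : nat).
Hypothesis char0 : [pchar K] =i pred0.
Hypothesis a_gt0 : (0 < a)%N.
Variable Y : 'I_b -> {set 'I_m}.
Hypothesis Ypart : is_set_partition a Y.
Variables (H : {group 'S_m}) (phi : {morphism H >-> 'S_b}).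
Hypothesis phiE : forall x j, x \in H -> x @: Y j = Y (phi x j).
Hypothesis memH : forall (x : 'S_m) (q : 'S_b), (forall j, x @: Y j = Y (q j)) -> x
  \in H.
Variable t : {ffun diagram [:: b] -> 'I_b}.
Hypothesis ht : is_tableau t.

Local Notation W := (pullback (young_morphism b m) (foulkes_ambient K [:: b] (b + m))).
Local Notation S la := (specht K b (parts la)).
Local Notation U := (summand_mx K m a.+1 t).

Let Y_inj : injective Y.
Proof.
have [cY dY _] := Ypart => j k e.
have /card_gt0P[l lj] : (0 < #|Y j|)%N by rewrite cY.
by apply: (dY _ _ l) => //; rewrite -e.
Qed.

Definition joined (Z : 'I_b -> {set 'I_m}) (l : 'I_b) : {set 'I_(b + m)} :=
  lshift m l |: (@rshift b m) @: Z l.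

Lemma young_joined g h (Z : 'I_b -> {set 'I_m}) l :
  young_perm (g, h) @: joined Z l = lshift m (g l) |: (@rshift b m) @: (h @: Z l).
Proof.
rewrite imsetU1 permE /young_fun (unsplitK (inl _)) /=; congr (_ |: _).
rewrite -!imset_comp; apply: eq_imset => k /=.
by rewrite permE /young_fun (unsplitK (inr _)).
Qed.

(** These vectors behave like the group elements [q]: by [omega_act], $S_b$ acts by left translation
    through inverses and $H$ by right translation through [phi]. *)
Definition omega (q : 'S_b) := basis_vec K (row_tabloid t (joined (Y \o q))).

Lemma omega_act q g h : h \in H -> omega q *m W (g, h) = omega (g^-1 * q * phi h)%g.
Proof.
move=> hH; rewrite [LHS]basis_tabloid_act; congr basis_vec.
transitivity (row_tabloid t (fun l => young_perm (g, h) @: joined (Y \o q) l)).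
  by congr tabloid; apply/ffunP=> d; rewrite !ffunE.
(* After the action, the block containing the letter [l] is the image of the block with index
   $g^{-1}l$. *)
apply/(row_tabloid_eq ht); exists (g^-1)%g => l.
by rewrite young_joined permKV /= phiE // /joined /= !permM.
Qed.

Lemma omega1_act h : omega 1%g *m W (1%g, h)
  = basis_vec K (row_tabloid t (joined (fun l => h @: Y l))).
Proof.
rewrite [LHS]basis_tabloid_act; congr basis_vec; congr tabloid.
apply/ffunP=> d; rewrite !ffunE.
rewrite -[LHS]/(young_perm (1%g, h) @: joined (Y \o (1%g : 'S_b)) (t d)).
by rewrite young_joined /joined /= !perm1.
Qed.

Lemma lshift_joined Z l j : (lshift m j \in joined Z l) = (j == l).
Proof.
rewrite !inE (inj_eq (@lshift_inj _ _)); case: eqP => //= _.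
by apply/imsetP=> -[k _ /eqP]; rewrite eq_lrshift.
Qed.

Lemma rshift_joined Z l k : (rshift b k \in joined Z l) = (k \in Z l).
Proof. by rewrite !inE eq_rlshift /= mem_imset //; apply: rshift_inj. Qed.

Lemma card_joined Z l : #|joined Z l| = #|Z l|.+1.
Proof.
rewrite cardsU1 card_imset ?(inj_eq (@lshift_inj _ _)) //; last exact: rshift_inj.
by case: imsetP => // -[k _ /eqP]; rewrite eq_lrshift.
Qed.

Lemma joined_inj Z Z' l l' : joined Z l = joined Z' l' -> l = l' /\ Z l = Z' l'.
Proof.
move=> e; split; first by apply/eqP; rewrite -(lshift_joined Z') -e lshift_joined.
by apply/setP=> k; rewrite -!rshift_joined e.
Qed.

Lemma joined_transversal Z : is_set_partition a Z ->
  [ffun l => joined Z l] \in transversal_partitions b m a.+1.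
Proof.
case=> cZ dZ covZ; rewrite inE; apply/andP; split.
  rewrite inE; apply/and3P; split.
  - by apply/forallP=> l; rewrite ffunE card_joined cZ.
  - apply/forallP=> l; apply/forallP=> l'; apply/implyP=> ll'.
    rewrite !ffunE disjoints_subset; apply/subsetP=> k; rewrite in_setC.
    case: (split_ordP k) => [j ->|j ->].
      by rewrite !lshift_joined => /eqP->.
    by rewrite !rshift_joined => jl; apply: contra ll' => jl'; apply/eqP/(dZ l l' j).
  - apply/eqP/setP=> k; rewrite in_setT; apply/bigcupP.
    case: (split_ordP k) => [j ->|j ->]; first by exists j;
      rewrite // ffunE lshift_joined.
    by have [l jl] := covZ j; exists l; rewrite // ffunE rshift_joined.
apply/forallP=> l; apply/cards1P; exists (lshift m l); rewrite ffunE.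
apply/setP=> k; rewrite in_setI in_set1; case: (split_ordP k) => [j ->|j ->].
  by rewrite lshift_joined imset_f // andbT (inj_eq (@lshift_inj _ _)).
rewrite eq_rlshift andbC; case: imsetP => // -[i _ /eqP].
by rewrite eq_rlshift.
Qed.

(** Blocks are reindexed by the unique letter of $\{1,\dots,b\}$ that they contain; this changes [X]
    but not its one-row tabloid. *)
Lemma transversal_joined X : X \in transversal_partitions b m a.+1 ->
  exists2 Z, is_set_partition a Z & row_tabloid t X = row_tabloid t (joined Z).
Proof.
rewrite inE => /andP[]; rewrite inE => /and3P[/forallP cX /forallP dX /eqP covX]
  /forallP trX.
have disjX l l' k : k \in X l -> k \in X l' -> l = l'.
  move=> kl kl'; apply/eqP; apply: contraT => ll'.
  have /implyP/(_ ll') := forallP (dX l) l'.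
  by rewrite disjoints_subset => /subsetP/(_ k kl); rewrite in_setC kl'.
have /fin_all_exists[s sE] l : exists j, X l :&: [set lshift m i | i : 'I_b] = [set
  lshift m j].
  have /cards1P[k kE] := trX l; have := set11 k;
    rewrite -kE => /setIP[_ /imsetP[j _ ej]].
  by exists j; rewrite kE ej.
have sX l j : (lshift m j \in X l) = (j == s l).
  have /setP/(_ (lshift m j)) := sE l.
  by rewrite in_setI imset_f // andbT in_set1 (inj_eq (@lshift_inj _ _)).
have inj_s : injective s by move=> l l' e; apply: (disjX _ _ (lshift m (s l)));
  rewrite sX // e.
pose p := (perm inj_s)^-1%g; pose Z l := [set k | rshift b k \in X (p l)].
have sp l : s (p l) = l by rewrite -(permE inj_s) permKV.
have XZ l : joined Z l = X (p l).
  apply/setP=> k; case: (split_ordP k) => [j ->|j ->].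
    by rewrite lshift_joined sX sp.
  by rewrite rshift_joined inE.
exists Z; last by apply/(row_tabloid_eq ht); exists p.
split=> [j|j k l|l].
- by apply: succn_inj; rewrite -card_joined XZ; apply/eqP/cX.
- by rewrite !inE => jl kl; apply: (@perm_inj _ p); apply: disjX kl.
have : rshift b l \in \bigcup_l X l by rewrite covX inE.
case/bigcupP=> j _ lj; exists (s j); rewrite inE.
by rewrite (_ : p (s j) = j) //; apply/inj_s; rewrite sp.
Qed.

Lemma set_partition_perm (q : 'S_b) : is_set_partition a (Y \o q).
Proof.
have [cY dY covY] := Ypart; split=> [j|j k l|l]; rewrite /= ?cY //.
  by move=> lj /(dY _ _ _ lj)/perm_inj.
by have [j lj] := covY l; exists ((q^-1)%g j); rewrite permKV.
Qed.

Lemma omega_in_summand q : (omega q <= U)%MS.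
Proof.
rewrite (sumsmx_sup [ffun l => joined (Y \o q) l]) //;
  first exact/joined_transversal/set_partition_perm.
rewrite /block_polytabloid row_polytabloid //.
have -> : row_tabloid t [ffun l => joined (Y \o q) l] = row_tabloid t (joined (Y \o q)).
  by congr tabloid; apply/ffunP=> d; rewrite !ffunE.
exact: cyclic_mx_id.
Qed.

Lemma phi_surj : phi @* H = [set: 'S_b].
Proof.
apply/setP=> q; rewrite inE; have [x xE] := set_partition_transitive Ypart
  (set_partition_perm q).
have xH := memH xE; apply/morphimP; exists x => //.
by apply/permP=> j; apply: Y_inj; rewrite -phiE // xE.
Qed.

(** The translates of [omega 1] under $S_m$ are basis vectors. Two of them agree only when the
    permutations differ by an element of the kernel of [phi], since the letters $1,\dots,b$ pin down
    the index of each block. As [phi] is onto $S_b$, that kernel has index $b!\,[S_m:H]$. *)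
Lemma rank_summand : (b`! * #|[set: 'S_m] : H| <= \rank U)%N.
Proof.
pose tab h := row_tabloid t (joined (fun l => (h : 'S_m) @: Y l)).
have tabE x y : tab x = tab y -> (x * y^-1)%g \in 'ker phi.
  case/(row_tabloid_eq ht) => p pE.
  have xy l : (x * y^-1)%g @: Y l = Y l.
    have [pl e] := joined_inj (pE l); rewrite -pl in e.
    by rewrite imset_permM -e -imset_permM mulgV imset_perm1.
  have xyH : (x * y^-1)%g \in H by apply: (memH (q := 1%g)) => j; rewrite perm1.
  by apply/kerP => //; apply/permP=> j; apply: Y_inj; rewrite -phiE // xy perm1.
have <- : (#|[set: 'S_m] : 'ker phi| = b`! * #|[set: 'S_m] : H|)%N.
  have kH : 'ker phi \subset H by apply: subsetIl.
  rewrite -(Lagrange_index (subsetT H) kH) mulnC; congr (_ * _)%N.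
  by rewrite -card_Sn -cardsT -phi_surj card_morphim setIid.
pose O := tab @: [set: 'S_m].
have leO : (#|[set: 'S_m] : 'ker phi| <= #|O|)%N.
  rewrite /indexg -(card_in_imset (f := fun A => tab (repr A))).
    by apply/subset_leq_card/subsetP=> _ /imsetP[A _ ->]; apply: imset_f.
  move=> _ _ /rcosetsP[x _ ->] /rcosetsP[y _ ->] /tabE.
  rewrite -mem_rcoset => /rcoset_eqP; rewrite !rcoset_repr; exact.
apply: leq_trans leO _; apply: leq_rank_basis_vec => _ /imsetP[h _ ->].
rewrite -omega1_act; apply: (mxmodule_trans (gen_mx_module _ _ _)); rewrite ?inE //.
exact: omega_in_summand.
Qed.

Section Coefficients.

Variable Ga : forall la : intpart b, 'M[K]_(rdegree (S la)).
Hypothesis Ga_unit : forall la, Ga la \in unitmx.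
Hypothesis GaJ : forall la g, S la g *m Ga la *m (S la g)^T = Ga la.

(** Sends the [j]-th basis vector to $\sum_q (S^\lambda(q)\,Ga)_{ij}\,\omega_q$. Without [Ga] the
    column index would transform by the dual of $S^\lambda$; the invariant form turns it back into
    $S^\lambda$, as [coef_mx_inner] uses. *)
Definition coef_mx la (i : 'I_(rdegree (S la))) : 'M_(rdegree (S la), rdegree W) :=
  \sum_q (row i (S la q *m Ga la))^T *m omega q.

Lemma coef_mx_inner la h i : h \in H ->
  pullback phi (S la) h *m coef_mx i = coef_mx i *m W (1%g, h).
Proof.
move=> hH; rewrite mulmx_sumr mulmx_suml (reindex_inj (mulIg (phi h))) /=.
apply: eq_bigr => q _; rewrite -[RHS]mulmxA omega_act // invg1 mul1g mulmxA.
congr (_ *m _); have rE : S la (q * phi h)%g = S la q *m S la (phi h).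
  by rewrite repr_mxM ?inE.
by rewrite rE; apply: (mul_tr_row (S la q) i (GaJ la (phi h))).
Qed.

Lemma coef_mx_outer la g i :
  \sum_k S la g i k *: coef_mx k = coef_mx i *m W (g, 1%g).
Proof.
rewrite [RHS]mulmx_suml (reindex_inj (mulgI g)) /=.
under eq_bigr do rewrite scaler_sumr.
rewrite exchange_big; apply: eq_bigr => q _.
rewrite -[RHS]mulmxA omega_act // morph1 mulg1 mulKg.
have -> : S la (g * q)%g = S la g *m S la q by rewrite repr_mxM ?inE.
rewrite -[S la g *m S la q *m _]mulmxA tr_row_mul mulmx_suml.
by apply: eq_bigr => k _; rewrite -scalemxAl.
Qed.

(** A linear functional vanishing on all matrix coefficients is a function $c$ on $S_b$ with $\sum_q
    c(q)S^\lambda(q)=0$ for all $\lambda$, hence zero by [specht_faithful]. *)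
Lemma omega_in_coef q : (omega q <= \sum_la \sum_i <<@coef_mx la i>>)%MS.
Proof.
(* The columns of the cokernel matrix [C] serve as the functionals that vanish on the span of the
   coefficients. *)
rewrite submxE; set A := (\sum_la _)%MS; set C := cokermx A.
have fC la i : @coef_mx la i *m C = 0.
  have : (<<@coef_mx la i>> <= A)%MS by rewrite (sumsmx_sup la) // (sumsmx_sup i).
  by rewrite genmxE => /submxP[D ->]; rewrite -mulmxA mulmx_coker mulmx0.
apply/eqP/rowP=> k; rewrite [RHS]mxE.
apply: (specht_faithful char0 (c := fun q => (omega q *m C) 0 k)) => la.
apply: (can_inj (mulmxK (Ga_unit la))); rewrite mul0mx mulmx_suml.
apply/matrixP=> i j; have /matrixP/(_ j k) := fC la i.
rewrite mulmx_suml !summxE => e; rewrite [RHS]mxE -[RHS](etrans e) ?mxE //.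
apply: eq_bigr => p _; rewrite -scalemxAl -[_ *m omega p *m C]mulmxA.
by rewrite col_mul_rowE [LHS]mxE mulrC.
Qed.

End Coefficients.

Theorem summand_rsim :
  mx_rsim (summand K m a.+1 t)
    (\big[dadd_grepr/grepr0]_(la : intpart b)
       outer_tensor (S la) (induced (pullback phi (S la)))).
Proof.
have /fin_all_exists[Ga GaP] : forall la : intpart b, exists Ga : 'M_(rdegree (S la)),
    Ga \in unitmx /\ forall g, S la g *m Ga *m (S la g)^T = Ga.
  by move=> la; have [Ga] := specht_parts_selfdual char0 la; exists Ga.
have Ga_unit la : Ga la \in unitmx by have [] := GaP la.
have GaJ la : forall g, S la g *m Ga la *m (S la g)^T = Ga la by have [] := GaP la.
pose F (la : intpart b) : 'M_(rdegree W) :=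
  (\sum_(i < rdegree (S la)) \sum_x <<coef_mx Ga i *m W (1%g, x)>>)%MS.
have sur la : surjects_onto (outer_tensor (S la) (induced (pullback phi (S la)))) W (F
  la).
  apply: surjects_onto_outer_induced => [h i hH|g i].
    exact: coef_mx_inner.
  exact: coef_mx_outer.
have {sur} := surjects_onto_dsum sur; set V := \big[_/_]_la _ => sur.
have modF := surjects_onto_module sur.
have FU : (\sum_la F la :=: U)%MS.
  apply/eqmxP/andP; split.
    apply/sumsmx_subP=> la _; apply/sumsmx_subP=> i _; apply/sumsmx_subP=> x _.
    rewrite genmxE (mxmodule_trans (gen_mx_module _ _ _)) ?inE //.
    apply: summx_sub => q _; apply: submx_trans (submxMl _ _) (omega_in_summand q).
  apply/sumsmx_subP=> X XT; apply: cyclic_mx_sub => //.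
  rewrite /block_polytabloid row_polytabloid //.
  have [Z Zpart ->] := transversal_joined XT.
  (* Every generator of $U$ is thus a translate of [omega 1] by $S_m$, and [omega 1] already lies in
     the coefficient span. *)
  have [x xE] := set_partition_transitive Ypart Zpart.
  have -> : row_tabloid t (joined Z) = row_tabloid t (joined (fun l => x @: Y l)).
    by congr tabloid; apply/ffunP=> d; rewrite !ffunE /joined xE.
  rewrite -omega1_act; apply: submx_trans (submxMr _ (omega_in_coef Ga_unit 1%g)) _.
  rewrite sumsmxMr; apply/sumsmx_subP=> la _; rewrite sumsmxMr; apply/sumsmx_subP=> i _.
  by rewrite (eqmxMr _ (genmxE _)) (sumsmx_sup la) // (sumsmx_sup i) // (sumsmx_sup x)
    ?genmxE.
have {}sur : surjects_onto V W U by have [B hB eB] := sur; exists B => //;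
  apply: eqmx_trans FU.
apply/mx_rsim_sym/(surjects_onto_rsim _ sur).
(* Each summand has dimension at most $d_\lambda\cdot d_\lambda[S_m:H]$ with $d_\lambda=\dim
   S^\lambda$, and $\sum_\lambda d_\lambda^2\le b!$. *)
apply: leq_trans rank_summand; rewrite /V rdegree_dsum.
apply: leq_trans (_ : \sum_(la : intpart b) rdegree (S la) ^ 2 * #|[set: 'S_m] : H| <=
  _)%N.
  apply: leq_sum => la _; rewrite -mulnn -mulnA leq_mul2l.
  by apply/orP; right; apply: rdegree_induced_le.
by rewrite -big_distrl /= leq_mul2r specht_sum_degree // orbT.
Qed.

End Transversal.

(** * The two instances: wreath product and singleton blocks *)

Lemma block_partition a b : (0 < a)%N -> is_set_partition a (@block a b).
Proof.
move=> a0; split=> [j|j k l|l].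
- have lt_ja (i : 'I_a) : (j * a + i < a * b)%N.
    apply: leq_trans (_ : j.+1 * a <= _)%N; first by rewrite mulSn addnC ltn_add2r.
    by rewrite mulnC leq_mul2l ltn_ord orbT.
  rewrite -[RHS](card_ord a) -(card_imset _ (f := fun i => Ordinal (lt_ja i))).
    apply: eq_card => k; rewrite inE; apply/eqP/imsetP => [kj|[i _ ->]].
      by exists (Ordinal (ltn_pmod k a0)) => //; apply/val_inj; rewrite /= -kj -divn_eq.
    by rewrite /= divnMDl // divn_small ?addn0.
  by move=> i i' [/addnI/val_inj].
- by rewrite !inE => /eqP jl /eqP kl; apply: val_inj; rewrite /= -jl.
have lt_lb : (l %/ a < b)%N by rewrite ltn_divLR // [leqRHS]mulnC ltn_ord.
by exists (Ordinal lt_lb); rewrite inE.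
Qed.

Lemma mem_wreath a b (x : 'S_(a * b)) (q : 'S_b) :
  (forall j, x @: block a j = block a (q j)) -> x \in wreath a b.
Proof.
move=> xq; rewrite !inE; apply/subsetP=> _ /imsetP[j _ ->].
rewrite inE; apply/imsetP; exists (q j) => //.
by rewrite -xq.
Qed.

Lemma dsum_rsim (K : fieldType) (gT : finGroupType) (G : {group gT}) (I : finType)
    (V V' : I -> representation K G) :
  (forall i, mx_rsim (V i) (V' i)) ->
  mx_rsim (\big[dadd_grepr/grepr0]_i V i) (\big[dadd_grepr/grepr0]_i V' i).
Proof.
move=> sim; elim/big_ind2: _ => // [|V1 V1' V2 V2' [B1 e1 f1 h1] [B2 e2 f2 h2]].
  exact: mx_rsim_refl.
exists (block_mx B1 0 0 B2) => [||g Gg]; first by rewrite /= e1 e2.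
  by rewrite /row_free rank_diag_block_mx (eqP f1) (eqP f2).
by rewrite !mulmx_block !mulmx0 !mul0mx !addr0 !add0r h1 ?h2.
Qed.

Theorem corollary2 (R : realType) (a b : nat) (ha : (2 <= a)%N) (hb : (2 <= b)%N)
    (t : {ffun diagram [:: b] -> 'I_b}) (ht : is_tableau t) :
  mx_rsim
    (summand R[i] (a.-1 * b) a t)
    (\big[dadd_grepr/grepr0]_(la : intpart b)
        outer_tensor (specht R[i] b (parts la)) (foulkes R[i] a.-1 b (parts la)))
  /\
  (a = 2%N ->
   mx_rsim
     (summand R[i] b a t)
     (\big[dadd_grepr/grepr0]_(la : intpart b)
         outer_tensor (specht R[i] b (parts la)) (specht R[i] b (parts la)))).
Proof.
have char0 : [pchar R[i]] =i pred0 by apply: Num.Theory.pchar_num.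
case: a ha => [|a] // a_gt0; rewrite ltnS in a_gt0; split.
  apply: (summand_rsim char0 a_gt0 (block_partition b a_gt0) (phi :=
    block_perm_morphism a b)) => //.
    by move=> x j xW; apply: block_permE.
  exact: mem_wreath.
case=> a1; rewrite a1 in a_gt0 *.
(* Here the remaining letters are indexed by [b] rather than [1 * b], so [summand_rsim] is applied
   afresh with singleton blocks and the identity of $S_b$ as block action; induction from the full
   group then changes nothing. *)
have spart : is_set_partition 1 (fun j : 'I_b => [set j]).
  split=> [j|j k l|l]; first exact: cards1.
    by rewrite !inE => /eqP<- /eqP.
  by exists l; rewrite set11.
have rsimM (M : representation R[i] [set: 'S_b]) :
    mx_rsim M (induced (pullback (idm_morphism [set: 'S_b]) M)).
  apply: mx_rsim_trans (induced_full_rsim _).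
  by exists 1%:M => // [|x _]; rewrite ?row_free_unit ?unitmx1 ?mulmx1 ?mul1mx.
apply: mx_rsim_trans (summand_rsim char0 a_gt0 spart (phi := idm_morphism [set: 'S_b])
  _ _ ht) _.
- by move=> x j _; rewrite imset_set1.
- by move=> x q _; rewrite in_setT.
apply: dsum_rsim => la; apply: outer_tensor_rsim.
exact/mx_rsim_sym/rsimM.
Qed.
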